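(* Let $a\in\mathbb H_+$ and let $b_a(p)=(p+\bar a)^{-\star}\star(p-a)$ be the corresponding Blaschke factor. The operator $$M_{b_a}:\ f\mapsto b_a\star f$$ is an isometry from $\mathbf H_2(\mathbb H_+)$ into itself.
   Context: $\mathbb H$: quaternions; $\mathbb H_+=\{p\in\mathbb H:\mathrm{Re}\,p>0\}$; $\mathbb S$: purely imaginary unit quaternions; $\mathbb C_I=\mathbb R+I\mathbb R$. A real differentiable $f:\mathbb H_+\to\mathbb H$ is slice hyperholomorphic if $(\partial_x+I\partial_y)f(x+Iy)=0$ on $\mathbb H_+\cap\mathbb C_I$ for every $I\in\mathbb S$; then $f(x+Iy)=\alpha(x,y)+I\beta(x,y)$ with $\alpha$ even and $\beta$ odd in $y$, not depending on $I$, and for $g=\gamma+I\delta$ one sets $(f\star g)(x+Iy)=(\alpha\gamma-\beta\delta)+I(\alpha\delta+\beta\gamma)$; $f^{-\star}$ is the $\star$-inverse. Explicitly $b_a(p)=(p^2+2\mathrm{Re}(a)p+|a|^2)^{-1}(p^2-a^2)$. $\mathbf H_2(\mathbb H_+)$ is the space of slice hyperholomorphic functions $f$ on $\mathbb H_+$ with $\sup_{I\in\mathbb S}\int_{-\infty}^{\infty}|f(Iy)|^2dy<\infty$, where $f(Iy)$ is the nontangential boundary value of $f|_{\mathbb C_I}$ and the restrictions of $f$ are in the Hardy class, so that $\int|f(Iy)|^2dy=\sup_{x>0}\int|f(x+Iy)|^2dy$. Its norm is $\|f\|_{\mathbf H_2(\mathbb H_+)}=\left(\sup_{I\in\mathbb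 S}\int_{-\infty}^\infty|f(Iy)|^2dy\right)^{1/2}$. *)

(* Defs.v *)
From HB Require Import structures.
From mathcomp Require Import all_boot all_order all_algebra ring lra.
From mathcomp Require Import all_classical all_reals all_analysis.

Set Implicit Arguments.
Unset Strict Implicit.
Unset Printing Implicit Defensive.

Import Order.TTheory GRing.Theory Num.Theory.
Import numFieldNormedType.Exports.

Local Open Scope classical_set_scope.
Local Open Scope ring_scope.

(* The quaternion q0 + q1 i + q2 j + q3 k is the row (q0, q1, q2, q3). The
   inherited topology is that of R^4; the inherited norm `|q| is the sup norm,
   so the quaternionic modulus is the separate function qnorm. *)
Definition quaternion (R : realType) : Type := 'rV[R]_4.

HB.instance Definition _ (R : realType) :=
  NormedModule.copy (quaternion R) 'rV[R]_4.

Section Quaternions.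
Variable R : realType.
Implicit Types p q r : quaternion R.

Definition quat (a b c d : R) : quaternion R :=
  \row_(i < 4) nth 0 [:: a; b; c; d] i.

Definition q0 p : R := p ord0 (@Ordinal 4 0 isT).
Definition q1 p : R := p ord0 (@Ordinal 4 1 isT).
Definition q2 p : R := p ord0 (@Ordinal 4 2 isT).
Definition q3 p : R := p ord0 (@Ordinal 4 3 isT).

Definition qmul p q : quaternion R :=
  quat (q0 p * q0 q - q1 p * q1 q - q2 p * q2 q - q3 p * q3 q)
       (q0 p * q1 q + q1 p * q0 q + q2 p * q3 q - q3 p * q2 q)
       (q0 p * q2 q - q1 p * q3 q + q2 p * q0 q + q3 p * q1 q)
       (q0 p * q3 q + q1 p * q2 q - q2 p * q1 q + q3 p * q0 q).

Definition qone : quaternion R := quat 1 0 0 0.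

Lemma qE a b c d :
  (q0 (quat a b c d) = a) * (q1 (quat a b c d) = b) *
  (q2 (quat a b c d) = c) * (q3 (quat a b c d) = d).
Proof. by rewrite /q0 /q1 /q2 /q3 !mxE. Qed.

Lemma qD p q :
  (q0 (p + q) = q0 p + q0 q) * (q1 (p + q) = q1 p + q1 q) *
  (q2 (p + q) = q2 p + q2 q) * (q3 (p + q) = q3 p + q3 q).
Proof. by rewrite /q0 /q1 /q2 /q3 !mxE. Qed.

Lemma qN p :
  (q0 (- p) = - q0 p) * (q1 (- p) = - q1 p) *
  (q2 (- p) = - q2 p) * (q3 (- p) = - q3 p).
Proof. by rewrite /q0 /q1 /q2 /q3 !mxE. Qed.

Lemma qZ (c : R) p :
  (q0 (c *: p) = c * q0 p) * (q1 (c *: p) = c * q1 p) *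
  (q2 (c *: p) = c * q2 p) * (q3 (c *: p) = c * q3 p).
Proof. by rewrite /q0 /q1 /q2 /q3 !mxE. Qed.

Lemma q00 :
  (q0 (0 : quaternion R) = 0) * (q1 (0 : quaternion R) = 0) *
  (q2 (0 : quaternion R) = 0) * (q3 (0 : quaternion R) = 0).
Proof. by rewrite /q0 /q1 /q2 /q3 !mxE. Qed.

Lemma quatP p q :
  q0 p = q0 q -> q1 p = q1 q -> q2 p = q2 q -> q3 p = q3 q -> p = q.
Proof.
move=> h0 h1 h2 h3; apply/rowP => -[[|[|[|[|//]]]] h].
- by rewrite (bool_irrelevance h isT).
- by rewrite (bool_irrelevance h isT).
- by rewrite (bool_irrelevance h isT).
- by rewrite (bool_irrelevance h isT).
Qed.

Lemma qmulA : associative qmul.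
Proof. by move=> p q r; apply: quatP; rewrite !qE; ring. Qed.
Lemma qmul1q : left_id qone qmul.
Proof. by move=> p; apply: quatP; rewrite !qE; ring. Qed.
Lemma qmulq1 : right_id qone qmul.
Proof. by move=> p; apply: quatP; rewrite !qE; ring. Qed.
Lemma qmulDl : left_distributive qmul +%R.
Proof. by move=> p q r; apply: quatP; rewrite !(qE, qD); ring. Qed.
Lemma qmulDr : right_distributive qmul +%R.
Proof. by move=> p q r; apply: quatP; rewrite !(qE, qD); ring. Qed.
Lemma qone_neq0 : qone != 0.
Proof.
apply/eqP => /(congr1 q0); rewrite !qE q00 => /eqP.
by rewrite oner_eq0.
Qed.

HB.instance Definition _ := GRing.Zmodule_isNzRing.Build (quaternion R)
  qmulA qmul1q qmulq1 qmulDl qmulDr qone_neq0.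

Lemma qM p q :
  (q0 (p * q) = q0 p * q0 q - q1 p * q1 q - q2 p * q2 q - q3 p * q3 q) *
  (q1 (p * q) = q0 p * q1 q + q1 p * q0 q + q2 p * q3 q - q3 p * q2 q) *
  (q2 (p * q) = q0 p * q2 q - q1 p * q3 q + q2 p * q0 q + q3 p * q1 q) *
  (q3 (p * q) = q0 p * q3 q + q1 p * q2 q - q2 p * q1 q + q3 p * q0 q).
Proof. by rewrite !qE. Qed.

Lemma q01 :
  (q0 (1 : quaternion R) = 1) * (q1 (1 : quaternion R) = 0) *
  (q2 (1 : quaternion R) = 0) * (q3 (1 : quaternion R) = 0).
Proof. by rewrite !qE. Qed.

Definition qre p : R := q0 p.
Definition qim p : quaternion R := quat 0 (q1 p) (q2 p) (q3 p).
Definition qconj p : quaternion R := quat (q0 p) (- q1 p) (- q2 p) (- q3 p).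
Definition qnorm p : R :=
  Num.sqrt (q0 p ^+ 2 + q1 p ^+ 2 + q2 p ^+ 2 + q3 p ^+ 2).

Lemma qnorm2E p :
  qnorm p ^+ 2 = q0 p ^+ 2 + q1 p ^+ 2 + q2 p ^+ 2 + q3 p ^+ 2.
Proof. by rewrite sqr_sqrtr// !addr_ge0// sqr_ge0. Qed.

Lemma qnorm_ge0 p : 0 <= qnorm p. Proof. exact: sqrtr_ge0. Qed.

(* H_+ *)
Definition half_space : set (quaternion R) := [set p | 0 < qre p].

(* the sphere S of purely imaginary unit quaternions *)
Definition imag_unit : set (quaternion R) :=
  [set I | qre I = 0 /\ qnorm I = 1].

(* x + I y *)
Definition slice_pt (I : quaternion R) (x y : R) : quaternion R :=
  x *: (1 : quaternion R) + y *: I.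

(* Functions on H_+ are total functions on quaternions of which only the
   values on H_+ are used. *)
Implicit Types f g h : quaternion R -> quaternion R.

Definition slice_hyperholomorphic f :=
  (forall p, half_space p -> differentiable f p) /\
  (forall I, imag_unit I -> forall x y : R, 0 < x ->
     derive1 (fun t : R => f (slice_pt I t y)) x
     + I * derive1 (fun t : R => f (slice_pt I x t)) y = 0).

(* The pair (alpha, beta) at (x, y) such that f(x + I y) = alpha + I beta for
   all I; it is unique when it exists, see stem_unique. *)
Definition stem f (x y : R) : quaternion R * quaternion R :=
  xget (0, 0) [set ab : quaternion R * quaternion R | forall I, imag_unit I ->
    f (slice_pt I x y) = ab.1 + I * ab.2].

(* For real p, I is 0 instead of an element of S; this is harmless because
   beta(x, 0) = 0. See starE. *)
Definition star f g : quaternion R -> quaternion R := fun p =>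
  let x := qre p in
  let y := qnorm (qim p) in
  let I := y^-1 *: qim p in
  let ab := stem f x y in
  let cd := stem g x y in
  (ab.1 * cd.1 - ab.2 * cd.2) + I * (ab.1 * cd.2 + ab.2 * cd.1).

Definition is_star_inverse f g :=
  slice_hyperholomorphic g /\
  forall p, half_space p -> star f g p = 1 /\ star g f p = 1.

(* f^{-*}; as a function on H_+ it is unique when it exists. *)
Definition star_inv f : quaternion R -> quaternion R :=
  xget (fun=> 0) [set g | is_star_inverse f g].

Definition blaschke (a : quaternion R) : quaternion R -> quaternion R :=
  star (star_inv (fun p => p + qconj a)) (fun p => p - a).

(* l is the limit of f(z) as z tends to I y0 inside every cone
   |y - y0| < k x of the half-plane x > 0 of C_I. *)
Definition nt_limit f (I : quaternion R) (y0 : R) (l : quaternion R) :=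
  forall k : R, 0 < k ->
    f (slice_pt I z.1 z.2) @[z --> within
        [set z : R * R | 0 < z.1 /\ `|z.2 - y0| < k * z.1]
        (nbhs ((0 : R), y0))] --> l.

(* f(I y); 0 where there is no nontangential limit *)
Definition bdry f (I : quaternion R) (y : R) : quaternion R :=
  xget 0 [set l | nt_limit f I y l].

Definition slice_energy f (I : quaternion R) (x : R) : \bar R :=
  \int[@lebesgue_measure R]_y ((qnorm (f (slice_pt I x y))) ^+ 2)%:E.

Definition bdry_energy f (I : quaternion R) : \bar R :=
  \int[@lebesgue_measure R]_y ((qnorm (bdry f I y)) ^+ 2)%:E.

(* Hardy class of the half-plane x > 0 of C_I: the mean squares on vertical
   lines are bounded and the nontangential boundary value exists a.e. *)
Definition slice_hardy f (I : quaternion R) :=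
  (ereal_sup [set slice_energy f I x | x in [set x : R | (0 < x)%R]] < +oo)%E /\
  {ae @lebesgue_measure R, forall y, exists l, nt_limit f I y l}.

Definition H2 f :=
  [/\ slice_hyperholomorphic f,
      (forall I, imag_unit I -> slice_hardy f I) &
      (ereal_sup [set bdry_energy f I | I in imag_unit] < +oo)%E].

Definition H2norm f : R :=
  Num.sqrt (fine (ereal_sup [set bdry_energy f I | I in imag_unit])).

Definition H2_isometry
    (M : (quaternion R -> quaternion R) -> (quaternion R -> quaternion R)) :=
  [/\ (forall f, H2 f -> H2 (M f)),
      (forall f, H2 f -> H2norm (M f) = H2norm f) &
      (forall f g, H2 f -> H2 g ->
         H2norm (fun p => M f p - M g p) = H2norm (fun p => f p - g p))].

Lemma imag_unit_sqr I : imag_unit I -> I * I = -1.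
Proof.
rewrite /imag_unit /qre /= => -[h0 h1].
have := qnorm2E I; rewrite h1 h0 => h2.
by apply: quatP; rewrite !(qM, qN, q01) h0; [move: h2; lra| | |]; ring.
Qed.

Lemma imag_unitN I : imag_unit I -> imag_unit (- I).
Proof.
rewrite /imag_unit /qre /qnorm /= => -[h0 h1].
by rewrite !qN !sqrrN h1 h0 oppr0.
Qed.

Lemma imag_unit_exists : imag_unit (quat 0 1 0 0).
Proof.
by rewrite /imag_unit /qre /qnorm /= !qE expr1n expr0n/= !(addr0, add0r) sqrtr1.
Qed.

Lemma stem_unique (x y : R) f (a b a' b' : quaternion R) :
  (forall I, imag_unit I -> f (slice_pt I x y) = a + I * b) ->
  (forall I, imag_unit I -> f (slice_pt I x y) = a' + I * b') ->
  a = a' /\ b = b'.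
Proof.
move=> h h'; pose I := quat 0 1 0 0.
have hI : imag_unit I := imag_unit_exists.
have e1 := h _ hI; rewrite (h' _ hI) in e1.
have e2 := h _ (imag_unitN hI); rewrite (h' _ (imag_unitN hI)) in e2.
have ea : a = a'.
  have e : a + a = a' + a'.
    rewrite -[LHS]addr0 -(subrr (I * b)) addrACA -e1 -mulNr -e2.
    by rewrite addrACA mulNr subrr addr0.
  have := congr1 (fun u => (2^-1 : R) *: u) e.
  have H (u : quaternion R) : (2^-1 : R) *: (u + u) = u.
    by apply: quatP; rewrite !(qZ, qD); field.
  by rewrite !H.
split=> //; move: e1; rewrite ea => /addrI /(congr1 ( *%R I)).
by rewrite !mulrA (imag_unit_sqr hI) !mulN1r => /oppr_inj.
Qed.

Lemma stemE (x y : R) f (a b : quaternion R) :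
  (forall I, imag_unit I -> f (slice_pt I x y) = a + I * b) ->
  stem f x y = (a, b).
Proof.
move=> h; rewrite /stem; case: xgetP => [ab _ h'|/(_ (a, b))].
  by have [-> ->] := stem_unique h h'; rewrite -surjective_pairing.
by case.
Qed.

Lemma slice_ptN I (x y : R) : slice_pt I x (- y) = slice_pt (- I) x y.
Proof. by rewrite /slice_pt scaleNr scalerN. Qed.

(* The product of slice functions is the one given by their components. *)
Lemma starE f g (al be ga de : R -> R -> quaternion R) :
  (forall I x y, imag_unit I -> 0 < x ->
     f (slice_pt I x y) = al x y + I * be x y) ->
  (forall I x y, imag_unit I -> 0 < x ->
     g (slice_pt I x y) = ga x y + I * de x y) ->
  forall I x y, imag_unit I -> 0 < x ->
    star f g (slice_pt I x y) =
      (al x y * ga x y - be x y * de x y)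
      + I * (al x y * de x y + be x y * ga x y).
Proof.
move=> hf hg I x y hI x0.
have sf y' : stem f x y' = (al x y', be x y').
  by apply: stemE => J hJ; exact: hf.
have sg y' : stem g x y' = (ga x y', de x y').
  by apply: stemE => J hJ; exact: hg.
have neg u (a b : R -> R -> quaternion R) :
    (forall I x y, imag_unit I -> 0 < x ->
       u (slice_pt I x y) = a x y + I * b x y) ->
    forall y', a x (- y') = a x y' /\ b x (- y') = - b x y'.
  move=> hu y'; apply: (@stem_unique x (- y') u) => J hJ; first exact: hu.
  by rewrite slice_ptN hu ?mulrN -?mulNr//; exact: imag_unitN.
have b0 u (a b : R -> R -> quaternion R) :
    (forall I x y, imag_unit I -> 0 < x ->
       u (slice_pt I x y) = a x y + I * b x y) -> b x 0 = 0.
  move=> hu; have [_] := neg u a b hu 0; rewrite oppr0 => /eqP.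
  rewrite -addr_eq0 -mulr2n -scaler_nat scaler_eq0 pnatr_eq0/=.
  by move/eqP.
have xE : qre (slice_pt I x y) = x.
  by rewrite /qre /slice_pt qD !qZ q01 (proj1 hI : q0 I = 0) mulr0 addr0 mulr1.
have imE : qim (slice_pt I x y) = y *: I.
  rewrite /qim /slice_pt; apply: quatP; rewrite !(qE, qD, qZ, q01).
  - by rewrite (proj1 hI : q0 I = 0) mulr0.
  - by rewrite mulr0 add0r.
  - by rewrite mulr0 add0r.
  - by rewrite mulr0 add0r.
have nE : qnorm (y *: I) = `|y|.
  have := proj2 hI; rewrite /qnorm !qZ !exprMn -!mulrDr.
  by rewrite sqrtrM ?sqr_ge0// sqrtr_sqr => ->; rewrite mulr1.
rewrite /star xE imE nE sf sg /=.
have [y0|y0|->] := ltgtP y 0.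
- rewrite ltr0_norm// !(proj1 (neg _ _ _ hf y), proj2 (neg _ _ _ hf y),
     proj1 (neg _ _ _ hg y), proj2 (neg _ _ _ hg y)).
  have -> : (- y)^-1 *: (y *: I) = - I.
    by rewrite scalerA invrN mulNr mulVf ?lt_eqF// scaleN1r.
  by rewrite !mulrN !mulNr opprK -opprD mulrN opprK.
- by rewrite gtr0_norm// scalerA mulVf ?gt_eqF// scale1r.
- by rewrite normr0 (b0 _ _ _ hf) (b0 _ _ _ hg) !(mul0r, mulr0, addr0).
Qed.

End Quaternions.

(* Main.v *)
From HB Require Import structures.
Require Import Defs.
From mathcomp Require Import all_boot all_order all_algebra ring lra.
From mathcomp Require Import all_classical all_reals all_analysis.
From mathcomp Require Import measurable_realfun.

(** Write a slice hyperholomorphic function as [f (x + I y) = al + I be], where the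
    components [al], [be] depend on [(x, y)] only; they satisfy the
    Cauchy-Riemann equations, [al] is even and [be] is odd in [y].  The star
    product is the product of components, so [M f = b * f] has the components
    [A = c al - d be] and [B = c be + d al] if [b = c + I d].

    The squared moduli of [M f] at [I y] and [- I y] add up to
    [2 (|A|^2 + |B|^2)].  On the boundary
    [b = (z^2 + 2 Re(a) z + |a|^2)^-1 (z^2 - a^2)] with [z^2 = - y^2] real, so
    that [c] and [d] are real multiples of one quaternion, with
    [|c|^2 + |d|^2 = 1]; then [|A|^2 + |B|^2 = |al|^2 + |be|^2] (bl_boundary).
    Hence [M f] and [f] have the same sum of squared boundary moduli at [I y]
    and [- I y], although in general not the same modulus at [I y].  Integrating over
    all real [y] counts both points, so the boundary energies agree on every
    slice (star_blaschke_bdry_energy) and so do the norms, which are their suprema.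
    Inside the half-space [|c|^2 + |d|^2 <= 1] (bl_le1), which bounds the mean
    squares of [M f] by those of [f] on two slices.  Since the star product is
    additive on functions with components, differences are handled by the
    same equality.

    Two facts about components carry the argument.  First, they exist: this is
    the representation formula (representation), which follows from the identity
    theorem for holomorphic functions that vanish on the real axis
    (cr_pair_zero).  As [f] is only assumed to be differentiable, with no
    continuity of its derivative, this theorem is obtained from Goursat's
    bisection argument (goursat) and a weight of the form
    [exp (lam * cos (kap * (z - z0)))], which for large [lam] isolates the value
    at [z0].  Conversely, holomorphic components define a slice
    hyperholomorphic function (slice_hyperholomorphic_of_stem), including
    differentiability at real points; this provides both the star inverse of
    [p + conj a] and the slice hyperholomorphy of [M f].

    The boundary function is 0 where the nontangential limit does not exist, on
    a null set that has no reason to be Borel.  Its energy is computed through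
    the upper limit of [|f|^2] along the vertical lines [x = 1 / (n + 1)], which
    is Borel and agrees with its squared modulus almost everywhere. *)

Set Implicit Arguments.
Unset Strict Implicit.
Unset Printing Implicit Defensive.

Import Order.TTheory GRing.Theory Num.Theory.
Import numFieldNormedType.Exports.

Local Open Scope classical_set_scope.
Local Open Scope ring_scope.

(** * Bisection of rectangles and Cauchy's theorem *)

Section RectangleIntegrals.
Variable R : realType.
Implicit Types a b c d x y e : R.

Lemma nested_halving (u : nat -> R) (w : R) : 0 < w ->
  (forall n, u n.+1 = u n \/ u n.+1 = u n + w / 2 ^+ n.+1) ->
  exists x, forall n, u n <= x <= u n + w / 2 ^+ n.
Proof.
move=> w0 hu.
have H n : u n <= u n.+1 /\ u n.+1 + w / 2 ^+ n.+1 <= u n + w / 2 ^+ n.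
  have p0 : 0 < w / 2 ^+ n.+1 by rewrite divr_gt0// exprn_gt0.
  have E : w / 2 ^+ n = w / 2 ^+ n.+1 + w / 2 ^+ n.+1.
    by rewrite exprS; field; apply: lt0r_neq0; exact: exprn_gt0.
  by case: (hu n) => ->; lra.
have up m n : u m <= u (m + n)%N.
  elim: n => [|n IH]; first by rewrite addn0.
  by rewrite addnS (le_trans IH)//; case: (H (m + n)%N).
have dn m n : u (m + n)%N + w / 2 ^+ (m + n) <= u m + w / 2 ^+ m.
  elim: n => [|n IH]; first by rewrite addn0.
  by rewrite addnS (le_trans _ IH)//; case: (H (m + n)%N).
have wn n : 0 <= w / 2 ^+ n by rewrite divr_ge0// ?exprn_ge0// ltW.
have bd n m : u m <= u n + w / 2 ^+ n.
  case/orP: (leq_total n m) => nm.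
    by have := dn n (m - n)%N; rewrite subnKC//; apply: le_trans; rewrite lerDl.
  by have := up m (n - m)%N; rewrite subnKC// => /le_trans; apply; rewrite lerDl.
exists (sup (range u)) => n; apply/andP; split.
  apply: ub_le_sup; last by exists n.
  by exists (u 0%N + w / 2 ^+ 0) => _ [m _ <-].
by apply: ge_sup; [exists (u 0%N), 0%N | move=> _ [m _ <-]].
Qed.

Lemma halving_cvg (w e : R) : 0 < w -> 0 < e -> exists n, w / 2 ^+ n < e.
Proof.
move=> w0 e0.
have c : (w / 2 ^+ n) @[n --> \oo] --> (0 : R).
  rewrite -[X in _ --> X](mulr0 w).
  under eq_fun do rewrite -exprVn.
  by apply: cvgMr; apply: cvg_expr; rewrite ger0_norm; lra.
have /cvgrPdist_lt/(_ _ e0)[N _ /(_ N (leqnn N))]/= := c.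
rewrite sub0r normrN ger0_norm ?divr_ge0 ?exprn_ge0 ?(ltW w0)// => h.
by exists N.
Qed.

(** Cousin's argument: if the conclusion failed, it would fail for one of the
    four quarters, then for a quarter of that quarter, and so on; the nested
    rectangles shrink to a point, where the local hypothesis is contradicted. *)
Lemma rect_bisection (E : R -> R -> R -> R -> Prop) a b c d : a < b -> c < d ->
  (forall a' b' c' d', a <= a' -> a' < b' -> b' <= b ->
     c <= c' -> c' < d' -> d' <= d ->
     let m := (a' + b') / 2 in let n := (c' + d') / 2 in
     E a' m c' n -> E m b' c' n -> E a' m n d' -> E m b' n d' ->
     E a' b' c' d') ->
  (forall x y, a <= x <= b -> c <= y <= d -> exists2 dl, 0 < dl &
     forall a' b' c' d', a <= a' -> a' < b' -> b' <= b ->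
       c <= c' -> c' < d' -> d' <= d ->
       a' <= x <= b' -> c' <= y <= d' -> b' - a' < dl -> d' - c' < dl ->
       E a' b' c' d') ->
  E a b c d.
Proof.
move=> ab cd split loc; apply: contrapT => nE.
pose W := b - a; pose H := d - c.
have W0 : 0 < W by rewrite subr_gt0.
have H0 : 0 < H by rewrite subr_gt0.
pose F n (p : R * R) := [/\ a <= p.1, p.1 + W / 2 ^+ n <= b, c <= p.2,
  p.2 + H / 2 ^+ n <= d &
  ~ E p.1 (p.1 + W / 2 ^+ n) p.2 (p.2 + H / 2 ^+ n)].
pose S n (p q : R * R) := (q.1 = p.1 \/ q.1 = p.1 + W / 2 ^+ n.+1) /\
  (q.2 = p.2 \/ q.2 = p.2 + H / 2 ^+ n.+1).
have step n p : F n p -> exists q, S n p q /\ F n.+1 q.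
  case=> h1 h2 h3 h4 h5.
  have w0 : 0 < W / 2 ^+ n.+1 by rewrite divr_gt0// exprn_gt0.
  have g0 : 0 < H / 2 ^+ n.+1 by rewrite divr_gt0// exprn_gt0.
  have EW (k : R) : k / 2 ^+ n = k / 2 ^+ n.+1 + k / 2 ^+ n.+1.
    by rewrite exprS; field; apply: lt0r_neq0; exact: exprn_gt0.
  move: h2 h4 h5; rewrite !EW.
  set w := W / _ in w0 *; set g := H / _ in g0 * => h2 h4 h5.
  apply: contrapT => hn; apply: h5.
  have Q q : S n p q -> E q.1 (q.1 + w) q.2 (q.2 + g).
    move=> Spq; apply: contrapT => nq; apply: hn; exists q; split=> //.
    by case: Spq => -[] e1 -[] e2; split => //; rewrite ?e1 ?e2 -/w -/g; lra.
  have m1 : (p.1 + (p.1 + (w + w))) / 2 = p.1 + w by field.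
  have m2 : (p.2 + (p.2 + (g + g))) / 2 = p.2 + g by field.
  apply: split => //; rewrite ?m1 ?m2 ?[p.1 + (w + w)]addrA ?[p.2 + (g + g)]addrA; try lra.
  - by apply: (Q (p.1, p.2)); split; left.
  - by apply: (Q (p.1 + w, p.2)); split; [right|left].
  - by apply: (Q (p.1, p.2 + g)); split; [left|right].
  - by apply: (Q (p.1 + w, p.2 + g)); split; right.
have F0 : F 0%N (a, c).
  by rewrite /F /= expr0 !divr1 /W /H !subrKC; split.
have {step} step n p : {q | F n p -> S n p q /\ F n.+1 q}.
  apply: cid; case: (pselect (F n p)) => [/step[q hq]|nF]; first by exists q.
  by exists p.
pose u := nat_rect (fun=> (R * R)%type) (a, c) (fun n p => sval (step n p)).
have Fu n : F n (u n).
  by elim: n => [//|n IH] /=; case: (svalP (step n (u n)) IH).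
have Su n : S n (u n) (u n.+1) by case: (svalP (step n (u n)) (Fu n)).
have [x hx] : exists x, forall n, (u n).1 <= x <= (u n).1 + W / 2 ^+ n.
  by apply: nested_halving => // n; case: (Su n).
have [y hy] : exists y, forall n, (u n).2 <= y <= (u n).2 + H / 2 ^+ n.
  by apply: nested_halving => // n; case: (Su n).
have xab : a <= x <= b.
  by have /= := hx 0%N; rewrite expr0 divr1 /W subrKC.
have ycd : c <= y <= d.
  by have /= := hy 0%N; rewrite expr0 divr1 /H subrKC.
have [dl dl0 hdl] := loc x y xab ycd.
have [n hn] := halving_cvg (addr_gt0 W0 H0) dl0.
have [h1 h2 h3 h4] := Fu n; apply.
have w0 : 0 < W / 2 ^+ n by rewrite divr_gt0// exprn_gt0.
have g0 : 0 < H / 2 ^+ n by rewrite divr_gt0// exprn_gt0.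
move: hn; rewrite mulrDl => hn.
by apply: hdl => //; lra.
Qed.

Lemma diff_approx (V W : normedModType R) (f : V -> W) (z : V) :
  differentiable f z -> forall e, 0 < e -> exists2 dl, 0 < dl &
    forall v, `|v| < dl -> `|f (z + v) - f z - 'd f z v| <= e * `|v|.
Proof.
move=> df e e0; have /eqaddoP/(_ _ e0) := diff_locally df.
move=> /nbhs_normP[dl /= dl0 hdl]; exists dl => // v vdl.
rewrite -addrA -opprD [z + v]addrC; apply: hdl.
by rewrite /ball_ /= sub0r normrN.
Qed.

Local Notation mu := (@lebesgue_measure R).

(** the integral of [P dx + Q dy] along the counterclockwise boundary *)
Definition circulation (P Q : R * R -> R) a b c d : R :=
  \int[mu]_(x in `[a, b]) P (x, c) - \int[mu]_(x in `[a, b]) P (x, d)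
  + \int[mu]_(y in `[c, d]) Q (b, y) - \int[mu]_(y in `[c, d]) Q (a, y).

Lemma integrable_itv (f : R -> R) a b :
  (forall x, a <= x <= b -> {for x, continuous f}) ->
  mu.-integrable `[a, b] (EFin \o f).
Proof.
move=> cf; apply: continuous_compact_integrable; first exact: segment_compact.
apply: continuous_in_subspaceT => x; rewrite inE/= in_itv/=; exact: cf.
Qed.

Lemma Rintegral_itv_split (f : R -> R) a m b : a <= m -> m <= b ->
  (forall x, a <= x <= b -> {for x, continuous f}) ->
  \int[mu]_(x in `[a, b]) f x =
  \int[mu]_(x in `[a, m]) f x + \int[mu]_(x in `[m, b]) f x.
Proof.
move=> am mb cf.
have := @Rintegral_itvB R f (BLeft a) (BRight b) m (integrable_itv cf).
rewrite !bnd_simp => /(_ am mb) e.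
rewrite -[X in _ + X]Rintegral_itv_obnd_cbnd; last first.
  apply: integrableS (integrable_itv cf) => //.
  by apply: subset_itvr; rewrite bnd_simp.
by rewrite -e subrKC.
Qed.

Lemma Rintegral_dist_cst (f : R -> R) (k e : R) a b : a <= b ->
  (forall x, a <= x <= b -> {for x, continuous f}) ->
  (forall x, a <= x <= b -> `|f x - k| <= e) ->
  `|\int[mu]_(x in `[a, b]) f x - k * (b - a)| <= e * (b - a).
Proof.
move=> ab cf h.
have iC (r : R) : \int[mu]_(x in `[a, b]) r = r * (b - a).
  rewrite Rintegral_cst//= lebesgue_measure_itv /= lte_fin.
  by case: ltgtP ab => //= -> _; rewrite subrr.
have cC (r : R) : mu.-integrable `[a, b] (EFin \o cst r).
  by apply: integrable_itv => x _; exact: cst_continuous.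
have ig := integrable_itv cf.
rewrite ler_norml; apply/andP; split.
  rewrite lerBrDr -mulNr -mulrDl -iC; apply: le_Rintegral => //; first exact: cC.
  by move=> x /=; rewrite in_itv/= => /h; rewrite ler_norml; lra.
rewrite lerBlDr -mulrDl -iC; apply: le_Rintegral => //; first exact: cC.
by move=> x /=; rewrite in_itv/= => /h; rewrite ler_norml; lra.
Qed.

Lemma continuous_row (P : R * R -> R) x y : differentiable P (x, y) ->
  {for x, continuous (fun t => P (t, y))}.
Proof.
move=> dP; apply: differentiable_continuous.
by apply: (@differentiable_comp _ _ _ _ (fun t => (t, y)) P).
Qed.

Lemma continuous_column (P : R * R -> R) x y : differentiable P (x, y) ->
  {for y, continuous (fun t => P (x, t))}.
Proof.
move=> dP; apply: differentiable_continuous.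
by apply: (@differentiable_comp _ _ _ _ (fun t => (x, t)) P).
Qed.

End RectangleIntegrals.

Section Cauchy.
Variable R : realType.
Implicit Types a b c d x y e : R.
Local Notation mu := (@lebesgue_measure R).

Lemma circulation_quarters (P Q : R * R -> R) a m b c n d :
  a <= m -> m <= b -> c <= n -> n <= d ->
  (forall x y, a <= x <= b -> c <= y <= d ->
    differentiable P (x, y) /\ differentiable Q (x, y)) ->
  circulation P Q a b c d = circulation P Q a m c n + circulation P Q m b c n
    + circulation P Q a m n d + circulation P Q m b n d.
Proof.
move=> am mb cn nd dPQ.
rewrite /circulation.
rewrite !(@Rintegral_itv_split _ (fun x => P (x, _)) a m b)//; last 2 first.
- by move=> x hx; apply: continuous_row; case: (@dPQ x d) => //; lra.
- by move=> x hx; apply: continuous_row; case: (@dPQ x c) => //; lra.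
rewrite !(@Rintegral_itv_split _ (fun y => Q (_, y)) c n d)//; last 2 first.
- by move=> y hy; apply: continuous_column; case: (@dPQ a y) => //; lra.
- by move=> y hy; apply: continuous_column; case: (@dPQ b y) => //; lra.
ring.
Qed.

Lemma diff_partials (W : normedModType R) (F : R * R -> W) (p : R * R) (s t : R) :
  'd F p (s, t) = s *: 'd F p (1, 0) + t *: 'd F p (0, 1).
Proof.
have -> : (s, t) = s *: (1, 0) + t *: (0, 1) :> R * R.
  by congr pair; rewrite /= !(scaler0, addr0, add0r) /GRing.scale /= mulr1.
by rewrite linearD !linearZ.
Qed.

(** The first-order terms [k * h * w] of the two pairs of sides cancel. *)
Lemma circulation_bound (i1 i2 i3 i4 k w h A B : R) :
  `|i1 - i2 + k * h * w| <= A -> `|i3 - i4 - k * w * h| <= B ->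
  `|i1 - i2 + i3 - i4| <= A + B.
Proof.
move=> hA hB; apply: le_trans (lerD hA hB); apply: le_trans (ler_normD _ _).
by rewrite le_eqVlt; apply/orP; left; apply/eqP; congr `|_|; ring.
Qed.

(** Goursat's argument: near a point the first-order parts of [P] and [Q]
    contribute opposite amounts to the circulation, so that over a small
    rectangle it is at most [e] times the square of the half-perimeter.  That
    bound passes from the four quarters to the whole, because halving the
    sides divides the square by exactly four; bisection thus gives it for the
    given rectangle, for every [e].  Only differentiability enters, which is all
    that slice hyperholomorphic functions provide. *)
Lemma goursat (P Q : R * R -> R) a b c d : a < b -> c < d ->
  (forall x y, a <= x <= b -> c <= y <= d ->
    [/\ differentiable P (x, y), differentiable Q (x, y) &
        'd P (x, y) (0, 1) = 'd Q (x, y) (1, 0)]) ->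
  circulation P Q a b c d = 0.
Proof.
move=> ab cd dPQ.
suff H e : 0 < e -> `|circulation P Q a b c d| <= e * (b - a + (d - c)) ^+ 2.
  apply/eqP; rewrite -normr_le0; apply/ler_addgt0Pr => e e0.
  have K0 : 0 < (b - a + (d - c)) ^+ 2 by rewrite exprn_gt0//; lra.
  rewrite add0r (le_trans (H (e / (b - a + (d - c)) ^+ 2) _)) ?divr_gt0//.
  by rewrite divfK// lt0r_neq0.
move=> e0.
apply: (@rect_bisection R (fun a b c d =>
   `|circulation P Q a b c d| <= e * (b - a + (d - c)) ^+ 2)) => //.
  move=> a' b' c' d' ha ab' hb hc cd' hd m n h1 h2 h3 h4.
  rewrite (@circulation_quarters P Q a' m b' c' n d'); first last.
  - by move=> x y hx hy; case: (@dPQ x y) => //; lra.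
  - by rewrite /n; lra.
  - by rewrite /n; lra.
  - by rewrite /m; lra.
  - by rewrite /m; lra.
  (* the square of the half-perimeter is four times that of each quarter *)
  set s := e * _ in h1.
  have E : e * (b' - a' + (d' - c')) ^+ 2 = s + s + s + s.
    by rewrite /s /m /n; field.
  have E2 : e * (b' - m + (n - c')) ^+ 2 = s by rewrite /s /m /n; field.
  have E3 : e * (m - a' + (d' - n)) ^+ 2 = s by rewrite /s /m /n; field.
  have E4 : e * (b' - m + (d' - n)) ^+ 2 = s by rewrite /s /m /n; field.
  rewrite E2 in h2; rewrite E3 in h3; rewrite E4 in h4.
  rewrite E (le_trans (ler_normD _ _))// lerD//.
  by rewrite (le_trans (ler_normD _ _))// lerD// (le_trans (ler_normD _ _))// lerD.
move=> x y hx hy; have [dP dQ PQ] := dPQ x y hx hy.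
have e40 : 0 < e / 4 by rewrite divr_gt0.
have [d1 d10 h1] := diff_approx dP e40.
have [d2 d20 h2] := diff_approx dQ e40.
exists (Num.min d1 d2); first by rewrite lt_min d10 d20.
move=> a' b' c' d' ha ab' hb hc cd' hd hx' hy'.
rewrite !lt_min => /andP[w1 w2] /andP[g1 g2].
have nv (s t : R) w : `|s| < w -> `|t| < w -> `|(s, t) : R * R| < w.
  by move=> ? ?; rewrite prod_normE/= gt_max; apply/andP.
have nw (s t : R) w : `|s| <= w -> `|t| <= w -> `|(s, t) : R * R| <= w.
  by move=> ? ?; rewrite prod_normE/= ge_max; apply/andP.
set w := b' - a' + (d' - c').
set p1 := 'd P (x, y) (1, 0); set p2 := 'd P (x, y) (0, 1).
set q2 := 'd Q (x, y) (0, 1).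
have loc (F : R * R -> R) dl s t :
    (forall v : R * R, `|v| < dl -> `|F ((x, y) + v) - F (x, y) - 'd F (x, y) v| <= e / 4 * `|v|) ->
    b' - a' < dl -> d' - c' < dl -> a' <= s <= b' -> c' <= t <= d' ->
    `|F (s, t) - F (x, y) - ((s - x) * 'd F (x, y) (1, 0) + (t - y) * 'd F (x, y) (0, 1))| <= e / 4 * w.
  move=> hF bd1 bd2 hs ht; have <- := diff_partials F (x, y) (s - x) (t - y).
  have n1 : `|s - x| <= b' - a' by rewrite ler_norml; clear - hs hx'; lra.
  have n2 : `|t - y| <= d' - c' by rewrite ler_norml; clear - ht hy'; lra.
  have := hF (s - x, t - y).
  have -> : (x, y) + (s - x, t - y) = (s, t) :> R * R.
    by congr pair; rewrite /= addrC subrK.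
  move=> /(_ _)/le_trans; apply.
    by apply: nv; [apply: le_lt_trans n1 _ | apply: le_lt_trans n2 _].
  by rewrite ler_pM2l//; apply: nw; rewrite /w; clear - n1 n2 ab' cd'; lra.
have cP t : c' <= t <= d' -> forall s, a' <= s <= b' ->
    {for s, continuous (fun x => P (x, t))}.
  by move=> ht s hs; apply: continuous_row; case: (@dPQ s t) => //; clear - hs ht ha hb hc hd; lra.
have cQ s : a' <= s <= b' -> forall t, c' <= t <= d' ->
    {for t, continuous (fun t => Q (s, t))}.
  by move=> ht t hs; apply: continuous_column; case: (@dPQ s t) => //; clear - hs ht ha hb hc hd; lra.
have cc' : c' <= c' <= d' by clear - cd'; lra.
have dd' : c' <= d' <= d' by clear - cd'; lra.
have aa' : a' <= a' <= b' by clear - ab'; lra.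
have bb' : a' <= b' <= b' by clear - ab'; lra.
have ew : 0 <= e / 4 * w by apply: mulr_ge0; rewrite /w; clear - ab' cd' e40; lra.
have IP : `|\int[mu]_(x in `[a', b']) P (x, c') - \int[mu]_(x in `[a', b']) P (x, d') + p2 * (d' - c') * (b' - a')| <= 2 * (e / 4 * w) * (b' - a').
  rewrite -RintegralB//; last 2 first.
  - by apply: integrable_itv; exact: cP.
  - by apply: integrable_itv; exact: cP.
  rewrite (_ : p2 * _ * _ = - (- (p2 * (d' - c')) * (b' - a'))); last first.
    by rewrite mulNr opprK.
  apply: Rintegral_dist_cst; first exact: ltW.
    move=> s hs; apply: cvgB; [exact: cP | exact: cP].
  move=> s hs.
  have l1 := loc P d1 s c' h1 w1 g1 hs cc'; have l2 := loc P d1 s d' h1 w1 g1 hs dd'.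
  rewrite mulr_natl mulr2n; apply: le_trans (lerD l1 l2).
  apply: le_trans (ler_normB _ _); rewrite -/p1 -/p2 le_eqVlt.
  by apply/orP; left; apply/eqP; congr `|_|; ring.
have IQ : `|\int[mu]_(y in `[c', d']) Q (b', y) - \int[mu]_(y in `[c', d']) Q (a', y) - p2 * (b' - a') * (d' - c')| <= 2 * (e / 4 * w) * (d' - c').
  rewrite -RintegralB//; last 2 first.
  - by apply: integrable_itv; exact: cQ.
  - by apply: integrable_itv; exact: cQ.
  apply: Rintegral_dist_cst; first exact: ltW.
    move=> s hs; apply: cvgB; [exact: cQ | exact: cQ].
  move=> t ht.
  have l1 := loc Q d2 b' t h2 w2 g2 bb' ht; have l2 := loc Q d2 a' t h2 w2 g2 aa' ht.
  rewrite mulr_natl mulr2n; apply: le_trans (lerD l1 l2).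
  apply: le_trans (ler_normB _ _); rewrite -/q2 -PQ -/p2 le_eqVlt.
  by apply/orP; left; apply/eqP; congr `|_|; ring.
have -> : e * w ^+ 2 = 2 * (e / 4 * w) * (b' - a') + 2 * (e / 4 * w) * (d' - c') + 2 * (e / 4 * w) * w.
  by rewrite /w; field.
have k0 : 0 <= 2 * (e / 4 * w) * w by rewrite mulr_ge0 ?mulr_ge0// /w; clear - ab' cd' e40; lra.
rewrite -[leLHS]addr0; apply: lerD k0; exact: circulation_bound IP IQ.
Qed.

End Cauchy.

(** * Functions of a complex variable in components *)

Section ComponentCalculus.
Variable R : realType.

(** The Cauchy-Riemann equations for [U + i V] at [z].  The values may lie in
    any normed space, so that the same notion serves for real pairs and for the
    pair of quaternionic components of a slice function. *)
Definition cr_pair (W : normedModType R) (U V : R * R -> W) (z : R * R) :=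
  exists dU dV : R * R -> W, [/\ is_diff z U dU, is_diff z V dV,
    dU (0, 1) = - dV (1, 0) & dV (0, 1) = dU (1, 0)].

Lemma is_diff_val (V W : normedModType R) (f df : V -> W) (z : V) :
  is_diff z f df -> 'd f z = df :> (V -> W).
Proof. by move=> h; exact: diff_val. Qed.

Lemma cr_pairD (W : normedModType R) (U V U' V' : R * R -> W) z :
  cr_pair U V z -> cr_pair U' V' z ->
  cr_pair (fun z => U z + U' z) (fun z => V z + V' z) z.
Proof.
move=> [dU [dV [hU hV e1 e2]]] [dU' [dV' [hU' hV' e1' e2']]].
exists (dU + dU'), (dV + dV'); split; [exact: is_diffD|exact: is_diffD| |].
  by rewrite !fctE e1 e1' opprD.
by rewrite !fctE e2 e2'.
Qed.

Lemma is_diff_derive (h : R -> R) (F dF : R * R -> R) (h' : R) z :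
  is_diff z F dF -> is_derive (F z) 1 h h' ->
  is_diff z (fun z => h (F z)) (fun v => h' * dF v).
Proof.
move=> hF [dh hh].
have Dh : is_diff (F z) h (fun t => t *: h').
  have d1 : differentiable h (F z) by apply/derivable1_diffP.
  by apply: DiffDef => //; rewrite diff1E// derive1E hh.
apply: (@is_diff_eq _ _ _ (h \o F)).
by apply/funext => v /=; rewrite /GRing.scale /= mulrC.
Qed.

Lemma is_diff_fst (z : R * R) : is_diff z (fun z => z.1) (fun v => v.1).
Proof.
pose d (v : R * R) : R := v.1.
have lind : linear d by [].
pose lM := GRing.isLinear.Build _ _ _ _ _ lind.
pose L : {linear _ -> _} := HB.pack d lM.
have c : continuous L by move=> ?; exact: cvg_fst.
by apply: DiffDef; [exact: (@linear_differentiable _ _ _ L) | rewrite (@diff_lin _ _ _ L)].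
Qed.

Lemma is_diff_snd (z : R * R) : is_diff z (fun z => z.2) (fun v => v.2).
Proof.
pose d (v : R * R) : R := v.2.
have lind : linear d by [].
pose lM := GRing.isLinear.Build _ _ _ _ _ lind.
pose L : {linear _ -> _} := HB.pack d lM.
have c : continuous L by move=> ?; exact: cvg_snd.
by apply: DiffDef; [exact: (@linear_differentiable _ _ _ L) | rewrite (@diff_lin _ _ _ L)].
Qed.

(** the map [a * (z - z0)] of the complex variable [z], for [a = k + l i] *)
Lemma cr_pair_linear (k l : R) (z0 z : R * R) :
  cr_pair (fun z => k * (z.1 - z0.1) - l * (z.2 - z0.2))
          (fun z => k * (z.2 - z0.2) + l * (z.1 - z0.1)) z.
Proof.
have h1 := is_diff_fst z; have h2 := is_diff_snd z.
have h3 := is_diffB h1 (is_diff_cst z0.1 z); have h4 := is_diffB h2 (is_diff_cst z0.2 z).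
have c1 := is_diffB (is_diffZ k h3) (is_diffZ l h4).
have c2 := is_diffD (is_diffZ k h4) (is_diffZ l h3).
eexists; eexists; split; [exact: c1|exact: c2| |];
  by rewrite !fctE /GRing.scale/= !(mulr0, mulr1, subr0, addr0, sub0r, add0r).
Qed.

(** Products of holomorphic functions are holomorphic; [m] may be the product of
    reals or the noncommutative product of quaternions, in which case this says
    that the star product preserves holomorphy of components. *)
Lemma cr_pairM (W1 W2 W3 : normedModType R) (m : W1 -> W2 -> W3)
    (U1 V1 : R * R -> W1) (U2 V2 : R * R -> W2) z :
  (forall p, is_diff p (fun q => m q.1 q.2) (fun q => m p.1 q.2 + m q.1 p.2)) ->
  (forall a b, m (- a) b = - m a b) -> (forall a b, m a (- b) = - m a b) ->
  cr_pair U1 V1 z -> cr_pair U2 V2 z ->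
  cr_pair (fun z => m (U1 z) (U2 z) - m (V1 z) (V2 z))
          (fun z => m (U1 z) (V2 z) + m (V1 z) (U2 z)) z.
Proof.
move=> md mNl mNr [dU1 [dV1 [u1 v1 e1 f1]]] [dU2 [dV2 [u2 v2 e2 f2]]].
have P f df g dg : is_diff z f df -> is_diff z g dg ->
    is_diff z (fun z => m (f z) (g z)) (fun v => m (f z) (dg v) + m (df v) (g z)).
  move=> hf hg; have hm := md (f z, g z).
  by apply: (@is_diff_eq _ _ _ ((fun p => m p.1 p.2) \o (fun z => (f z, g z)))).
have D1 := is_diffB (P _ _ _ _ u1 u2) (P _ _ _ _ v1 v2).
have D2 := is_diffD (P _ _ _ _ u1 v2) (P _ _ _ _ v1 u2).
have k1 (a b c d : W3) : (- a + - d) - (c + b) = - ((a + b) + (c + d)).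
  by rewrite -!opprD [c + b]addrC addrACA [d + c]addrC.
have k2 (p q r s : W3) : (p + - q) + (- r + s) = (p + s) - (r + q).
  by rewrite opprD addrACA [- q + s]addrC addrACA.
eexists; eexists; split; [exact: D1|exact: D2| |]; rewrite !fctE.
  by rewrite e1 f1 e2 f2 !mNr !mNl k1.
by rewrite e1 f1 e2 f2 !mNr !mNl k2.
Qed.

Lemma cr_pairM_real (U1 V1 U2 V2 : R * R -> R) z :
  cr_pair U1 V1 z -> cr_pair U2 V2 z ->
  cr_pair (fun z => U1 z * U2 z - V1 z * V2 z)
          (fun z => U1 z * V2 z + V1 z * U2 z) z.
Proof.
by apply: cr_pairM => [a b|a b]; [exact: mulNr | exact: mulrN].
Qed.

Lemma cr_pair_exp (U V : R * R -> R) z : cr_pair U V z ->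
  cr_pair (fun z => expR (U z) * cos (V z)) (fun z => expR (U z) * sin (V z)) z.
Proof.
move=> [dU [dV [u v e f]]].
have he := is_diff_derive u (is_derive_expR (U z)).
have hc := is_diff_derive v (is_derive_cos (V z)).
have hs := is_diff_derive v (is_derive_sin (V z)).
have c1 := is_diffM he hc; have c2 := is_diffM he hs.
eexists; eexists; split; [exact: c1|exact: c2| |]; rewrite !fctE /GRing.scale/= e f; ring.
Qed.

(** Cauchy's theorem for the real part of [f dz]. *)
Lemma cr_pair_circulation (U V : R * R -> R) a b c d : a < b -> c < d ->
  (forall x y, a <= x <= b -> c <= y <= d -> cr_pair U V (x, y)) ->
  circulation U (fun z => - V z) a b c d = 0.
Proof.
move=> ab cd h; apply: goursat => // x y hx hy; have [dU [dV [u v e _]]] := h x y hx hy.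
have v' := is_diffN v.
by split; [exact: ex_diff | exact: ex_diff | rewrite (is_diff_val u) (is_diff_val v') fctE].
Qed.
End ComponentCalculus.

(** * The identity theorem on the half-plane *)

Section Laplace.
Variable R : realType.
Local Notation mu := (@lebesgue_measure R).

Lemma Rintegral_ge_cst (f : R -> R) (k : R) (a b : R) : a <= b ->
  (forall x, a <= x <= b -> {for x, continuous f}) ->
  (forall x, a <= x <= b -> k <= f x) ->
  k * (b - a) <= \int[mu]_(x in `[a, b]) f x.
Proof.
move=> ab cf h.
have <- : \int[mu]_(x in `[a, b]) (cst k) x = k * (b - a).
  rewrite Rintegral_cst//= lebesgue_measure_itv /= lte_fin.
  by case: ltgtP ab => //= -> _; rewrite subrr.
apply: le_Rintegral => //.
- by apply: integrable_itv => x _; exact: cst_continuous.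
- exact: integrable_itv.
Qed.

Lemma bounded_itv (f : R -> R) (a b : R) : a <= b ->
  (forall x, a <= x <= b -> {for x, continuous f}) ->
  exists2 M, 0 <= M & forall x, a <= x <= b -> `|f x| <= M.
Proof.
move=> ab cf.
have cn : {within `[a, b], continuous (fun x => `|f x|)}.
  apply: continuous_in_subspaceT => x; rewrite inE/= in_itv/= => hx.
  by apply: cvg_norm; exact: cf.
have [c _ hc] := EVT_max ab cn.
by exists `|f c| => // x hx; apply: hc; rewrite in_itv.
Qed.

(** Laplace's method: as [lam] grows, the weight
    [exp (lam * cos (pi / r * (x - x0)))] concentrates at [x0], so that a
    positive value of [u x0] would make the integral large. *)
Lemma laplace_zero_ge (u : R -> R) (x0 r C : R) : 0 < r ->
  (forall x, x0 - r <= x <= x0 + r -> {for x, continuous u}) ->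
  (forall lam : R, 0 <= lam ->
    \int[mu]_(x in `[x0 - r, x0 + r])
       (u x * expR (lam * cos (pi / r * (x - x0)))) <= C * expR (- lam)) ->
  u x0 <= 0.
Proof.
move=> r0 cu hC; rewrite leNgt; apply/negP => c0.
have x0r : x0 - r <= x0 <= x0 + r by lra.
have [M M0 hM] : exists2 M, 0 <= M & forall x, x0 - r <= x <= x0 + r -> `|u x| <= M.
  by apply: bounded_itv => //; lra.
have [d d0 [dr hd]] : exists2 d, 0 < d & d < r /\ forall x, `|x - x0| <= d -> u x0 / 2 <= u x.
  have /cvgrPdist_lt/(_ (u x0 / 2))[|e /= e0 he] := cu x0 x0r; first by rewrite divr_gt0.
  exists (Num.min (e / 2) (r / 2)); first by rewrite lt_min !divr_gt0.
  split; first by rewrite gt_min; apply/orP; right; lra.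
  move=> x; rewrite le_min => /andP[xe _].
  have : `|x0 - x| < e by rewrite distrC; lra.
  by move=> /he; rewrite ltr_norml; lra.
pose k := pi / r; have k0 : 0 < k by rewrite divr_gt0// pi_gt0.
have kr : k * r = pi by rewrite /k divfK// gt_eqF.
pose c1 := cos (k * (d / 2)); pose c2 := cos (k * d).
have kd : k * d < pi by rewrite -kr ltr_pM2l.
have kd0 : 0 < k * (d / 2) by rewrite mulr_gt0// divr_gt0.
have kE : k * (d / 2) + k * (d / 2) = k * d by field.
have c12 : c2 < c1 by rewrite /c1 /c2 ltr_cos ?in_itv/=; lra.
have ccos (lam x : R) : {for x, continuous (fun x => expR (lam * cos (k * (x - x0))))}.
  apply: differentiable_continuous; apply/derivable1_diffP.
  have h : is_derive x 1 (fun x => k * (x - x0)) (k * (1 - 0)) by apply: is_deriveZ.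
  apply: ex_derive.
have ci (lam x : R) : x0 - r <= x <= x0 + r ->
    {for x, continuous (fun x => u x * expR (lam * cos (k * (x - x0))))}.
  by move=> hx; apply: cvgM; [exact: cu | exact: ccos].
(* elsewhere it is bounded below by a multiple of the smaller [exp (lam * c2)] *)
have far (lam x : R) : 0 <= lam -> x0 - r <= x <= x0 + r -> d / 2 <= `|x - x0| ->
    - M * expR (lam * c2) <= u x * expR (lam * cos (k * (x - x0))).
  move=> l0 hx xd2; have [xd|xd] := leP `|x - x0| d.
    apply: (@le_trans _ _ 0).
      by rewrite mulNr oppr_le0 mulr_ge0// expR_ge0.
    by rewrite mulr_ge0 ?expR_ge0//; have := hd x xd; lra.
  have e1 : cos (k * (x - x0)) <= c2.
    have m1 : k * `|x - x0| \in `[0, pi].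
      by rewrite in_itv/= mulr_ge0 ?(ltW k0)//= -kr ler_pM2l// ler_norml; lra.
    have m2 : k * d \in `[0, pi].
      by rewrite in_itv/= mulr_ge0 ?(ltW k0) ?(ltW d0)//= ltW.
    by rewrite -cos_norm normrM (gtr0_norm k0) /c2 le_eqVlt ltr_cos// ltr_pM2l// xd orbT.
  have e2 : expR (lam * cos (k * (x - x0))) <= expR (lam * c2) by rewrite ler_expR ler_wpM2l.
  rewrite mulNr lerNl -mulNr; apply: (@le_trans _ _ (M * expR (lam * cos (k * (x - x0))))).
    rewrite ler_wpM2r ?expR_ge0//; have := hM x hx; rewrite ler_norml; lra.
  by rewrite ler_wpM2l.
(* close to [x0] the integrand is at least this positive multiple of [exp (lam * c1)] *)
have near (lam x : R) : 0 <= lam -> `|x - x0| <= d / 2 ->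
    u x0 / 2 * expR (lam * c1) <= u x * expR (lam * cos (k * (x - x0))).
  move=> l0 xd; have e1 : c1 <= cos (k * (x - x0)).
    have m1 : k * `|x - x0| \in `[0, pi].
      by rewrite in_itv/= mulr_ge0 ?(ltW k0)//= -kr ler_pM2l//; lra.
    have m2 : k * (d / 2) \in `[0, pi] by rewrite in_itv/= ltW//=; lra.
    by rewrite -[leRHS]cos_norm normrM (gtr0_norm k0) /c1 leNgt ltr_cos// ltr_pM2l// -leNgt.
  apply: ler_pM; rewrite ?expR_ge0//; first by rewrite divr_ge0// ltW.
    by apply: hd; lra.
  by rewrite ler_expR ler_wpM2l.
have key lam : 0 <= lam ->
    u x0 / 2 * expR (lam * c1) * d - 2 * r * (M * expR (lam * c2)) <= C * expR (- lam).
  move=> l0; apply: le_trans (hC _ l0).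
  rewrite (@Rintegral_itv_split _ _ _ (x0 - d / 2)); [|lra|lra|exact: ci].
  rewrite (@Rintegral_itv_split _ _ (x0 - d / 2) (x0 + d / 2)); [|lra|lra|].
    2: by move=> x hx; apply: ci; lra.
  have i1 := @Rintegral_ge_cst (fun x => u x * expR (lam * cos (k * (x - x0)))) (- M * expR (lam * c2)) (x0 - r) (x0 - d / 2).
  have i2 := @Rintegral_ge_cst (fun x => u x * expR (lam * cos (k * (x - x0)))) (u x0 / 2 * expR (lam * c1)) (x0 - d / 2) (x0 + d / 2).
  have i3 := @Rintegral_ge_cst (fun x => u x * expR (lam * cos (k * (x - x0)))) (- M * expR (lam * c2)) (x0 + d / 2) (x0 + r).
  apply: le_trans (lerD (i1 _ _ _) (lerD (i2 _ _ _) (i3 _ _ _))).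
  - have : 0 <= d * (M * expR (lam * c2)) by rewrite !mulr_ge0 ?expR_ge0// ltW.
    by lra.
  - lra.
  - by move=> x hx; apply: ci; lra.
  - by move=> x hx; apply: far => //; [|rewrite ler_normr]; lra.
  - lra.
  - by move=> x hx; apply: ci; lra.
  - by move=> x hx; apply: near => //; rewrite ler_norml; lra.
  - lra.
  - by move=> x hx; apply: ci; lra.
  - by move=> x hx; apply: far => //; [|rewrite ler_normr]; lra.
have Cc lam : 0 <= lam -> C * expR (- lam) <= `|C| * expR (lam * c2).
  move=> l0; apply: (@le_trans _ _ (`|C| * expR (- lam))).
    by rewrite ler_wpM2r ?expR_ge0// ler_norm.
  rewrite ler_wpM2l// ler_expR -[- lam]mulr1 mulNr -mulrN ler_wpM2l//.
  exact: cos_geN1.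
pose K := 2 * r * M + `|C|.
have K0 : 0 <= K by rewrite addr_ge0// !mulr_ge0// ltW.
have fin lam : 0 <= lam -> u x0 / 2 * d * expR (lam * (c1 - c2)) <= K.
  move=> l0; have := le_trans (key _ l0) (Cc _ l0).
  have -> : lam * c1 = lam * (c1 - c2) + lam * c2 by ring.
  rewrite expRD -(@ler_pM2r _ (expR (lam * c2)) _ _ K) ?expR_gt0// /K.
  set E := expR (lam * c2); set F := expR (lam * _); lra.
have p0 : 0 < u x0 / 2 * d * (c1 - c2).
  by rewrite mulr_gt0 ?subr_gt0// mulr_gt0// divr_gt0.
(* a value of [lam] for which [1 + t <= exp t] already contradicts the bound [fin] *)
have l0 : 0 <= K / (u x0 / 2 * d * (c1 - c2)) by rewrite divr_ge0// ltW.
have := fin _ l0; apply/negP; rewrite -ltNge.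
apply: (@lt_le_trans _ _ (u x0 / 2 * d * (1 + K / (u x0 / 2 * d * (c1 - c2)) * (c1 - c2)))); last first.
  by rewrite ler_wpM2l ?expR_ge1Dx// mulr_ge0 ?divr_ge0// ltW.
have -> : u x0 / 2 * d * (1 + K / (u x0 / 2 * d * (c1 - c2)) * (c1 - c2)) = u x0 / 2 * d + K.
  by field; rewrite !gt_eqF// subr_gt0.
by rewrite ltrDr mulr_gt0// divr_gt0.
Qed.
End Laplace.

Section IdentityTheorem.
Variable R : realType.
Local Notation mu := (@lebesgue_measure R).

Lemma cr_pairZ (k : R) (U V : R * R -> R) z : cr_pair U V z ->
  cr_pair (fun z => k * U z) (fun z => k * V z) z.
Proof.
move=> [dU [dV [u v e f]]].
have u' := is_diffZ k u; have v' := is_diffZ k v.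
by eexists; eexists; split; [exact: u'|exact: v'| |];
  rewrite !fctE /GRing.scale/= ?e ?f ?mulrN.
Qed.

(** real and imaginary parts of [cos (kap * (z - z0))] *)
Definition cos_re (kap : R) (z0 z : R * R) : R :=
  (expR (- (kap * (z.2 - z0.2))) + expR (kap * (z.2 - z0.2))) / 2
  * cos (kap * (z.1 - z0.1)).
Definition cos_im (kap : R) (z0 z : R * R) : R :=
  (expR (- (kap * (z.2 - z0.2))) - expR (kap * (z.2 - z0.2))) / 2
  * sin (kap * (z.1 - z0.1)).

Lemma cr_pair_cos kap z0 z : cr_pair (cos_re kap z0) (cos_im kap z0) z.
Proof.
have h1 := cr_pair_exp (cr_pair_linear 0 kap z0 z).
have h2 := cr_pair_exp (cr_pair_linear 0 (- kap) z0 z).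
have := cr_pairZ 2^-1 (cr_pairD h1 h2).
congr cr_pair; apply/funext => w; rewrite /cos_re /cos_im /=.
  rewrite !mul0r !add0r !mulNr opprK cosN; ring.
rewrite !mul0r !add0r !mulNr opprK sinN; ring.
Qed.

(** On the vertical lines where the real part of the angle is [pi] or [- pi],
    the cosine is [- cosh], real and at most [-1] however high one goes. *)
Lemma cos_re_sides kap z0 (x y : R) :
  kap * (x - z0.1) = pi \/ kap * (x - z0.1) = - pi ->
  cos_re kap z0 (x, y) <= - 1 /\ cos_im kap z0 (x, y) = 0.
Proof.
have ch : 1 <= (expR (- (kap * (y - z0.2))) + expR (kap * (y - z0.2))) / 2.
  have := expR_ge1Dx (kap * (y - z0.2)); have := expR_ge1Dx (- (kap * (y - z0.2))).
  lra.
by case=> e; rewrite /cos_re /cos_im /= e ?sinN ?cosN sinpi cospi ?oppr0 mulr0 mulrN1 lerN2.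
Qed.

Lemma cos_re_axis kap z0 (x : R) :
  cos_re kap z0 (x, z0.2) = cos (kap * (x - z0.1)) /\
  cos_im kap z0 (x, z0.2) = 0.
Proof.
by rewrite /cos_re /cos_im /= subrr mulr0 oppr0 expR0 subrr !mul0r -mulr2n divff// mul1r.
Qed.

(** Half of the identity theorem.  With the weight
    [exp (lam * cos (pi / r * (z - z0)))], where [z0 = x0 + i y0] and
    [r = x0 / 2], Cauchy's theorem on the rectangle
    between the axis and the horizontal line through [z0] leaves only the
    integral along that line and the two sides, on which the weight is at most
    [exp (- lam)]; the bottom side is on the axis, where the function vanishes. *)
Lemma cr_pair_zero_le (U V : R * R -> R) :
  (forall x y : R, 0 < x -> cr_pair U V (x, y)) ->
  (forall x : R, 0 < x -> U (x, 0) = 0 /\ V (x, 0) = 0) ->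
  forall x0 y0 : R, 0 < x0 -> 0 < y0 -> U (x0, y0) <= 0.
Proof.
move=> hUV h0 x0 y0 x00 y00.
pose r := x0 / 2; have r0 : 0 < r by rewrite divr_gt0.
pose a := x0 - r; pose b := x0 + r.
have a0 : 0 < a by rewrite /a /r; lra.
have b0 : 0 < b by rewrite /b /r; lra.
pose kap : R := pi / r.
have dV (x y : R) : 0 < x -> differentiable V (x, y).
  by move=> /(hUV x y)[dU [dV [_ v _ _]]]; exact: ex_diff.
have dU (x y : R) : 0 < x -> differentiable U (x, y).
  by move=> /(hUV x y)[dU [dV' [u _ _ _]]]; exact: ex_diff.
have [Ma Ma0 hMa] : exists2 M, 0 <= M & forall y, 0 <= y <= y0 -> `|V (a, y)| <= M.
  apply: (@bounded_itv _ (fun y => V (a, y))); first exact: ltW.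
  by move=> y _; apply: continuous_column; exact: dV.
have [Mb Mb0 hMb] : exists2 M, 0 <= M & forall y, 0 <= y <= y0 -> `|V (b, y)| <= M.
  apply: (@bounded_itv _ (fun y => V (b, y))); first exact: ltW.
  by move=> y _; apply: continuous_column; exact: dV.
apply: (@laplace_zero_ge R (fun x => U (x, y0)) x0 r ((Ma + Mb) * y0)) => //.
  move=> x hx; apply: continuous_row; apply: dU; move: a0; rewrite /a; lra.
move=> lam l0; rewrite -/a -/b -/kap.
have hW z := cr_pair_exp (cr_pairZ lam (cr_pair_cos kap (x0, y0) z)).
pose P z := U z * (expR (lam * cos_re kap (x0, y0) z) * cos (lam * cos_im kap (x0, y0) z))
  - V z * (expR (lam * cos_re kap (x0, y0) z) * sin (lam * cos_im kap (x0, y0) z)).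
pose Q z := U z * (expR (lam * cos_re kap (x0, y0) z) * sin (lam * cos_im kap (x0, y0) z))
  + V z * (expR (lam * cos_re kap (x0, y0) z) * cos (lam * cos_im kap (x0, y0) z)).
have PQ (x y : R) : 0 < x -> cr_pair P Q (x, y).
  by move=> x0'; exact: cr_pairM_real (hUV x y x0') (hW (x, y)).
have := @cr_pair_circulation R P Q a b 0 y0.
have -> : circulation P (fun z => - Q z) a b 0 y0 =
  - (\int[mu]_(x in `[a, b]) (U (x, y0) * expR (lam * cos (kap * (x - x0)))))
  + \int[mu]_(y in `[0, y0]) (- Q (b, y)) - \int[mu]_(y in `[0, y0]) (- Q (a, y)).
  rewrite /circulation.
  have -> : \int[mu]_(x in `[a, b]) P (x, 0) = 0.
    rewrite (@eq_Rintegral _ _ _ _ _ (cst 0)) ?Rintegral_cst ?mul0r//.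
    move=> x; rewrite inE/= in_itv/= => hx.
    have [u v] : U (x, 0) = 0 /\ V (x, 0) = 0 by apply: h0; move: a0; lra.
    by rewrite /P u v !mul0r subrr.
  have -> : \int[mu]_(x in `[a, b]) P (x, y0) =
      \int[mu]_(x in `[a, b]) (U (x, y0) * expR (lam * cos (kap * (x - x0)))).
    apply: eq_Rintegral => x _.
    have [c s] := cos_re_axis kap (x0, y0) x; rewrite /= in c s.
    by rewrite /P c s mulr0 cos0 sin0 mulr1 !mulr0 subr0.
  by rewrite sub0r.
have side (c M : R) : 0 < c -> (kap * (c - x0) = pi \/ kap * (c - x0) = - pi) ->
    0 <= M -> (forall y, 0 <= y <= y0 -> `|V (c, y)| <= M) ->
    `|\int[mu]_(y in `[0, y0]) (- Q (c, y))| <= M * y0 * expR (- lam).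
  move=> c0 hc M0 hM.
  have -> : M * y0 * expR (- lam) = M * expR (- lam) * (y0 - 0) by ring.
  have := @Rintegral_dist_cst R (fun y => - Q (c, y)) 0 (M * expR (- lam)) 0 y0.
  rewrite mul0r subr0; apply; first exact: ltW.
    move=> y _; apply: cvgN; apply: continuous_column.
    by have [dP [dQ [_ q _ _]]] := PQ c y c0; exact: ex_diff.
  move=> y hy; rewrite subr0 normrN.
  have [cr ci] := @cos_re_sides kap (x0, y0) c y hc.
  rewrite /Q ci mulr0 sin0 cos0 !mulr0 add0r mulr1 normrM (ger0_norm (expR_ge0 _)).
  apply: ler_pM => //; first exact: hM.
  by rewrite ler_expR; have := ler_wpM2l l0 cr; rewrite mulrN1.
have kr : kap * r = pi by rewrite /kap divfK// gt_eqF.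
have sa := side a Ma a0 _ Ma0 hMa; have sb := side b Mb b0 _ Mb0 hMb.
move=> /(_ _ _ _)/eqP E.
have /sa{}sa : kap * (a - x0) = pi \/ kap * (a - x0) = - pi.
  by right; rewrite /a addrAC subrr add0r mulrN kr.
have /sb{}sb : kap * (b - x0) = pi \/ kap * (b - x0) = - pi.
  by left; rewrite /b addrAC subrr add0r kr.
have : - (\int[mu]_(x in `[a, b]) (U (x, y0) * expR (lam * cos (kap * (x - x0)))))
  + \int[mu]_(y in `[0, y0]) (- Q (b, y)) - \int[mu]_(y in `[0, y0]) (- Q (a, y)) = 0.
  apply/eqP; apply: E => //; first by rewrite /a /b; lra.
  by move=> x y hx _; apply: PQ; move: a0; lra.
move: sa sb; rewrite !ler_norml.
set i1 := \int[mu]_(_ in _) _; set i2 := \int[mu]_(_ in _) _; set i3 := \int[mu]_(_ in _) _.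
lra.
Qed.

(** The bound applied to the pair and to its opposite. *)
Lemma cr_pair_zero (U V : R * R -> R) :
  (forall x y : R, 0 < x -> cr_pair U V (x, y)) ->
  (forall x : R, 0 < x -> U (x, 0) = 0 /\ V (x, 0) = 0) ->
  forall x0 y0 : R, 0 < x0 -> 0 < y0 -> U (x0, y0) = 0.
Proof.
move=> hUV h0 x0 y0 x00 y00; apply: le_anti; apply/andP; split.
  exact: (cr_pair_zero_le hUV).
rewrite -oppr_le0 -mulN1r.
apply: (@cr_pair_zero_le (fun z => -1 * U z) (fun z => -1 * V z)) => //.
  by move=> x y hx; apply: cr_pairZ; exact: hUV.
by move=> x /h0[-> ->]; rewrite mulr0.
Qed.
End IdentityTheorem.

(** * Quaternionic calculus *)

Section QuatCalc.
Variable R : realType.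
Implicit Types p q : quaternion R.

Lemma qmulZl (k : R) p q : (k *: p) * q = k *: (p * q).
Proof. by apply: quatP; rewrite !(qM, qZ); ring. Qed.

Lemma qmulZr (k : R) p q : p * (k *: q) = k *: (p * q).
Proof. by apply: quatP; rewrite !(qM, qZ); ring. Qed.

Lemma q_coord_continuous (T : topologicalType) (f : T -> quaternion R) (t : T) :
  {for t, continuous f} ->
  [/\ {for t, continuous (fun s => q0 (f s))}, {for t, continuous (fun s => q1 (f s))},
      {for t, continuous (fun s => q2 (f s))} & {for t, continuous (fun s => q3 (f s))}].
Proof.
move=> cf; split; apply: (@continuous_comp _ _ _ f) => //; exact: coord_continuous.
Qed.

(** Continuity reduces to the four real coordinates. *)
Lemma quat_decomp p : p = q0 p *: quat 1 0 0 0 + q1 p *: quat 0 1 0 0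
  + q2 p *: quat 0 0 1 0 + q3 p *: quat 0 0 0 1.
Proof. by apply: quatP; rewrite !(qD, qZ, qE); ring. Qed.

Lemma quat_continuous (T : topologicalType) (f : T -> quaternion R) (t : T) :
  {for t, continuous (fun s => q0 (f s))} -> {for t, continuous (fun s => q1 (f s))} ->
  {for t, continuous (fun s => q2 (f s))} -> {for t, continuous (fun s => q3 (f s))} ->
  {for t, continuous f}.
Proof.
move=> c0 c1 c2 c3.
rewrite (_ : f = fun s => q0 (f s) *: quat 1 0 0 0 + q1 (f s) *: quat 0 1 0 0
  + q2 (f s) *: quat 0 0 1 0 + q3 (f s) *: quat 0 0 0 1); last first.
  by apply/funext => s; exact: quat_decomp.
by apply: cvgD; [apply: cvgD; [apply: cvgD|]|]; apply: cvgZr_tmp || apply: cvgZl_tmp || apply: cvgZ.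
Qed.

Lemma qmul_is_bilinear :
  bilinear_for
    (GRing.Scale.Law.clone _ _ *:%R _) (GRing.Scale.Law.clone _ _ *:%R _)
    (@GRing.mul (quaternion R)).
Proof.
split=> [u'|u] a x y /=.
- by rewrite mulrDl qmulZl.
- by rewrite mulrDr qmulZr.
Qed.
Lemma qmul_continuous (T : topologicalType) (f g : T -> quaternion R) (t : T) :
  {for t, continuous f} -> {for t, continuous g} ->
  {for t, continuous (fun s => f s * g s)}.
Proof.
move=> /q_coord_continuous[f0 f1 f2 f3] /q_coord_continuous[g0 g1 g2 g3].
apply: quat_continuous; rewrite /prop_for /continuous_at qM; under eq_fun do rewrite qM.
- by apply: cvgB; [apply: cvgB; [apply: cvgB|]|]; apply: cvgM.
- by apply: cvgB; [apply: cvgD; [apply: cvgD|]|]; apply: cvgM.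
- by apply: cvgD; [apply: cvgD; [apply: cvgB|]|]; apply: cvgM.
- by apply: cvgD; [apply: cvgB; [apply: cvgD|]|]; apply: cvgM.
Qed.

Lemma is_diff_qmul (p : quaternion R * quaternion R) :
  is_diff p (fun u => u.1 * u.2) (fun u => p.1 * u.2 + u.1 * p.2).
Proof.
have cm : continuous (fun q : quaternion R * quaternion R => q.1 * q.2).
  by move=> q; apply: qmul_continuous; [exact: cvg_fst | exact: cvg_snd].
pose bM := bilinear_isBilinear.Build R (quaternion R) (quaternion R)
  (quaternion R) _ _ (@GRing.mul (quaternion R)) qmul_is_bilinear.
pose L : {bilinear quaternion R -> quaternion R -> quaternion R} :=
  HB.pack (@GRing.mul (quaternion R)) bM.
by apply: DiffDef; [exact: (@differentiable_bilin _ _ _ _ L) | rewrite (@diff_bilin _ _ _ _ L)].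
Qed.

Lemma is_diff_mulq (V : normedModType R) (f df g dg : V -> quaternion R) z :
  is_diff z f df -> is_diff z g dg ->
  is_diff z (fun z => f z * g z) (fun v => f z * dg v + df v * g z).
Proof.
move=> hf hg; have hm := is_diff_qmul (f z, g z).
by apply: (@is_diff_eq _ _ _ ((fun u => u.1 * u.2) \o (fun z => (f z, g z)))).
Qed.

Lemma is_diff_mulql (V : normedModType R) (f df : V -> quaternion R) (c : quaternion R) z :
  is_diff z f df -> is_diff z (fun z => c * f z) (fun v => c * df v).
Proof.
move=> hf; apply: (is_diff_eq (is_diff_mulq (is_diff_cst c z) hf)).
by apply/funext => v; rewrite /= mul0r addr0.
Qed.

Lemma cr_pairM_quat (U1 V1 U2 V2 : R * R -> quaternion R) z :
  cr_pair U1 V1 z -> cr_pair U2 V2 z ->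
  cr_pair (fun z => U1 z * U2 z - V1 z * V2 z)
          (fun z => U1 z * V2 z + V1 z * U2 z) z.
Proof.
by apply: cr_pairM => [|a b|a b]; [exact: is_diff_qmul | exact: mulNr | exact: mulrN].
Qed.

Lemma is_diff_lin (V W : normedModType R) (d : V -> W) (z : V) :
  linear d -> continuous d -> is_diff z d d.
Proof.
move=> lind c; pose lM := GRing.isLinear.Build _ _ _ _ _ lind.
pose L : {linear _ -> _} := HB.pack d lM.
by apply: DiffDef; [exact: (@linear_differentiable _ _ _ L) | rewrite (@diff_lin _ _ _ L)].
Qed.

Lemma is_diff_q0 p : is_diff p (@q0 R) (@q0 R).
Proof.
apply: is_diff_lin => [k u v|]; first by rewrite qD qZ.
exact: coord_continuous.
Qed.
Lemma is_diff_q1 p : is_diff p (@q1 R) (@q1 R).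
Proof.
apply: is_diff_lin => [k u v|]; first by rewrite qD qZ.
exact: coord_continuous.
Qed.
Lemma is_diff_q2 p : is_diff p (@q2 R) (@q2 R).
Proof.
apply: is_diff_lin => [k u v|]; first by rewrite qD qZ.
exact: coord_continuous.
Qed.
Lemma is_diff_q3 p : is_diff p (@q3 R) (@q3 R).
Proof.
apply: is_diff_lin => [k u v|]; first by rewrite qD qZ.
exact: coord_continuous.
Qed.

Lemma is_diff_slice_pt (I : quaternion R) (z : R * R) :
  is_diff z (fun z => slice_pt I z.1 z.2) (fun v => v.1 *: (1 : quaternion R) + v.2 *: I).
Proof.
apply: is_diff_lin => [k u v|].
  by rewrite /slice_pt /= !scalerDl !scalerDr !scalerA addrACA.
by move=> w; apply: cvgD; apply: cvgZr_tmp; [exact: cvg_fst | exact: cvg_snd].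
Qed.

Lemma qre_slice_pt (I : quaternion R) (x y : R) : imag_unit I -> qre (slice_pt I x y) = x.
Proof. by move=> [h _]; rewrite /qre /slice_pt qD !qZ q01 (h : q0 I = 0) mulr0 addr0 mulr1. Qed.

Lemma derive1_is_diff (W : normedModType R) (h dh : R -> W) (x : R) :
  is_diff x h dh -> derive1 h x = dh 1.
Proof. by move=> hh; rewrite derive1E' ?(is_diff_val hh)//; exact: ex_diff. Qed.

(** In the complex structure given by left multiplication by [I], the
    restriction of [f] to the half-plane of [C_I] is holomorphic. *)
Lemma slice_restriction (f : quaternion R -> quaternion R) (I : quaternion R) (x y : R) :
  slice_hyperholomorphic f -> imag_unit I -> 0 < x ->
  exists2 dF : R * R -> quaternion R,
    is_diff (x, y) (fun z => f (slice_pt I z.1 z.2)) dF & dF (0, 1) = I * dF (1, 0).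
Proof.
move=> [df cr] hI x0.
have [dfp hf] : exists dfp, is_diff (slice_pt I x y) f dfp.
  eexists; apply: differentiableP; apply: df.
  by rewrite /half_space /= qre_slice_pt.
have hs := is_diff_slice_pt I (x, y).
have hF : is_diff (x, y) (fun z => f (slice_pt I z.1 z.2))
    (dfp \o (fun v => v.1 *: (1 : quaternion R) + v.2 *: I)).
  exact: (@is_diff_comp _ _ _ _ (fun z => slice_pt I z.1 z.2) _ f).
exists (dfp \o (fun v => v.1 *: (1 : quaternion R) + v.2 *: I)) => //=.
rewrite !scale0r !scale1r addr0 add0r.
have := cr I hI x y x0.
have h1 : is_diff x (fun t => f (slice_pt I t y)) (fun t => dfp (t *: (1 : quaternion R))).
  have hp := is_diff_pair (is_diff_id x) (is_diff_cst y x).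
  apply: (@is_diff_eq _ _ _ ((fun z => f (slice_pt I z.1 z.2)) \o (fun t => (t, y)))).
  by apply/funext => t /=; rewrite scale0r addr0.
have h2 : is_diff y (fun t => f (slice_pt I x t)) (fun t => dfp (t *: I)).
  have hp := is_diff_pair (is_diff_cst x y) (is_diff_id y).
  apply: (@is_diff_eq _ _ _ ((fun z => f (slice_pt I z.1 z.2)) \o (fun t => (x, t)))).
  by apply/funext => t /=; rewrite scale0r add0r.
rewrite (derive1_is_diff h1) (derive1_is_diff h2) !scale1r => /(congr1 ( *%R I)).
rewrite mulr0 mulrDr mulrA (imag_unit_sqr hI) mulN1r => /eqP.
by rewrite subr_eq0 => /eqP.
Qed.
End QuatCalc.

(** * The representation formula *)

Section Representation.
Variable R : realType.
Implicit Types (f : quaternion R -> quaternion R) (I J : quaternion R).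

(** For every quaternion [k], the pair [Re (k g)], [- Re (k I g)] satisfies the
    Cauchy-Riemann equations, which reduces the quaternionic identity theorem to
    the scalar one. *)
Lemma slice_identity (I : quaternion R) (g : R * R -> quaternion R) : imag_unit I ->
  (forall x y : R, 0 < x -> exists2 dg : R * R -> quaternion R,
     is_diff (x, y) g dg & dg (0, 1) = I * dg (1, 0)) ->
  (forall x : R, 0 < x -> g (x, 0) = 0) ->
  forall x y : R, 0 < x -> 0 < y -> g (x, y) = 0.
Proof.
move=> hI hg g0 x y x0 y0.
have K (k : quaternion R) : q0 (k * g (x, y)) = 0.
  apply: (@cr_pair_zero _ (fun z => q0 (k * g z)) (fun z => - q0 ((k * I) * g z))) => //.
    move=> x' y' x0'; have [dg hd e] := hg x' y' x0'.
    have h1 := is_diff_comp (is_diff_mulql k hd) (is_diff_q0 (k * g (x', y'))).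
    have h2 := is_diffN (is_diff_comp (is_diff_mulql (k * I) hd) (is_diff_q0 ((k * I) * g (x', y')))).
    exists (fun v => q0 (k * dg v)), (fun v => - q0 ((k * I) * dg v)); split.
    - exact: h1.
    - exact: h2.
    - by rewrite e opprK mulrA.
    - by rewrite e -mulrA (mulrA I) (imag_unit_sqr hI) mulN1r mulrN qN opprK.
  by move=> x' /g0 ->; rewrite !mulr0 q00 oppr0.
apply: quatP; rewrite q00.
- by have := K 1; rewrite mul1r.
- by have := K (quat 0 1 0 0); rewrite qM !qE; lra.
- by have := K (quat 0 0 1 0); rewrite qM !qE; lra.
- by have := K (quat 0 0 0 1); rewrite qM !qE; lra.
Qed.

(** for slice hyperholomorphic [f] the components below do not depend on this
    choice of an imaginary unit *)
Definition stem_unit : quaternion R := quat 0 1 0 0.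

Definition stem_re f (z : R * R) : quaternion R :=
  (2^-1 : R) *: (f (slice_pt stem_unit z.1 z.2) + f (slice_pt (- stem_unit) z.1 z.2)).
Definition stem_im f (z : R * R) : quaternion R :=
  (2^-1 : R) *: (stem_unit * (f (slice_pt (- stem_unit) z.1 z.2) - f (slice_pt stem_unit z.1 z.2))).

(** The representation formula: on the slice of [I] both sides are holomorphic
    for left multiplication by [I], and they agree on the real axis.  The point
    is that [c1 * J = I * c1] and [c2 * (- J) = I * c2], so that multiplying by
    [c1] and [c2] transports the complex structures of [J] and [- J] to that
    of [I]. *)
Lemma representation f : slice_hyperholomorphic f ->
  forall I (x y : R), imag_unit I -> 0 < x ->
    f (slice_pt I x y) = stem_re f (x, y) + I * stem_im f (x, y).
Proof.
move=> hf I x y hI x0.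
have hJ : imag_unit stem_unit := @imag_unit_exists R.
have hJ' := imag_unitN hJ.
set J := stem_unit in hJ hJ' *.
have JJ := imag_unit_sqr hJ.
have half (p : quaternion R) : (2^-1 : R) *: p + (2^-1 : R) *: p = p.
  by rewrite -scalerDl (_ : 2^-1 + 2^-1 = 1 :> R) ?scale1r//; field.
have pos I' (y' : R) : imag_unit I' -> 0 < y' ->
    f (slice_pt I' x y') = stem_re f (x, y') + I' * stem_im f (x, y').
  move=> hI' y0'.
  have II := imag_unit_sqr hI'.
  pose c1 : quaternion R := (2^-1 : R) *: (1 - I' * J).
  pose c2 : quaternion R := (2^-1 : R) *: (1 + I' * J).
  pose g z := f (slice_pt I' z.1 z.2) - (c1 * f (slice_pt J z.1 z.2) + c2 * f (slice_pt (- J) z.1 z.2)).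
  have c1J : c1 * J = I' * c1.
    rewrite /c1 qmulZr qmulZl; congr (_ *: _).
    by rewrite mulrBr mulrBl mulr1 mul1r -mulrA JJ mulrA II mulrN1 mulN1r !opprK addrC.
  have c2J : - (c2 * J) = I' * c2.
    rewrite /c2 qmulZr qmulZl -scalerN; congr (_ *: _).
    by rewrite mulrDr mulrDl mulr1 mul1r -mulrA JJ mulrA II mulrN1 mulN1r opprD opprK addrC.
  have gE : g (x, y') = 0.
    apply: (slice_identity hI') => // [s t s0|s s0].
      have [d1 h1 e1] := slice_restriction t hf hI' s0.
      have [d2 h2 e2] := slice_restriction t hf hJ s0.
      have [d3 h3 e3] := slice_restriction t hf hJ' s0.
      have h := is_diffB h1 (is_diffD (is_diff_mulql c1 h2) (is_diff_mulql c2 h3)).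
      exists (fun v => d1 v - (c1 * d2 v + c2 * d3 v)); first exact: h.
      by rewrite e1 e2 e3 mulrBr mulrDr !mulrA c1J mulrN c2J.
    rewrite /g /slice_pt /= !scale0r !addr0 -mulrDl.
    rewrite /c1 /c2 -scalerDr addrACA addNr addr0.
    by rewrite scalerDr half mul1r subrr.
  move/eqP: gE; rewrite /g /= subr_eq0 => /eqP ->.
  rewrite /stem_re /stem_im /c1 /c2 -/J /= !qmulZl qmulZr -!scalerDr; congr (_ *: _).
  by rewrite mulrBl mulrDl !mul1r mulrA mulrBr addrACA [- _ + _]addrC.
have stemN y' : stem_re f (x, - y') = stem_re f (x, y') /\ stem_im f (x, - y') = - stem_im f (x, y').
  rewrite /stem_re /stem_im /= !slice_ptN opprK [X in (_ *: X = _) /\ _]addrC; split => //.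
  by rewrite -scalerN -mulrN opprB.
have [y0|y0|->] := ltgtP y 0.
- rewrite -[y]opprK slice_ptN pos ?oppr_gt0//; last exact: imag_unitN.
  by have [-> ->] := stemN (- y); have [-> ->] := stemN y; rewrite opprK mulNr mulrN opprK.
- exact: pos.
- rewrite /stem_re /stem_im /slice_pt /= !scale0r !addr0 subrr mulr0 scaler0 mulr0 addr0.
  by rewrite scalerDr half.
Qed.

Lemma stem_cr_pair f (x y : R) : slice_hyperholomorphic f -> 0 < x ->
  cr_pair (stem_re f) (stem_im f) (x, y).
Proof.
move=> hf x0.
have hJ : imag_unit stem_unit := @imag_unit_exists R.
have [d2 h2 e2] := slice_restriction y hf hJ x0.
have [d3 h3 e3] := slice_restriction y hf (imag_unitN hJ) x0.
have JJ := imag_unit_sqr hJ.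
have D1 := is_diffZ (2^-1 : R) (is_diffD h2 h3).
have D2 := is_diffZ (2^-1 : R) (is_diff_mulql stem_unit (is_diffB h3 h2)).
exists (fun v => (2^-1 : R) *: (d2 v + d3 v)), (fun v => (2^-1 : R) *: (stem_unit * (d3 v - d2 v))).
split; [exact: D1|exact: D2| |].
  by rewrite e2 e3 -scalerN mulNr -mulrBr -mulrN opprB.
by rewrite e2 e3 mulNr -opprD mulrN -mulrDr mulrA JJ mulN1r opprK addrC.
Qed.
End Representation.

(** * Norms and slice coordinates of quaternions *)

Section StemDiff.
Variable R : realType.

Lemma differentiable_of_eps (V W : normedModType R) (F L : V -> W) (p : V) :
  linear L -> continuous L ->
  (forall e, 0 < e -> exists2 d, 0 < d &
     forall v, `|v| < d -> `|F (p + v) - F p - L v| <= e * `|v|) ->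
  differentiable F p.
Proof.
move=> lind c h; pose lM := GRing.isLinear.Build _ _ _ _ _ lind.
pose L' : {linear _ -> _} := HB.pack L lM.
have H : F \o shift p = cst (F p) + L' +o_ (0 : V) id.
  apply/eqaddoP => e e0; have [d d0 hd] := h e e0.
  apply/nbhs_normP; exists d => //= v; rewrite /ball_ /= sub0r normrN => vd.
  by have := hd v vd; rewrite [p + v]addrC -addrA -opprD; apply.
have E : 'd F p = L' :> (V -> W) by exact: diff_unique.
by apply/diff_locallyP; rewrite E.
Qed.

Lemma near_differentiable (V W : normedModType R) (F G : V -> W) (p : V) :
  (\forall q \near p, F q = G q) -> differentiable G p -> differentiable F p.
Proof.
move=> FG dG; apply: (@differentiable_of_eps _ _ F ('d G p)).
- exact: linearP.
- exact: diff_continuous.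
move=> e e0; have [d1 d10 h1] := diff_approx dG e0.
have /nbhs_normP[d2 /= d20 h2] := FG.
exists (Num.min d1 d2); first by rewrite lt_min d10.
move=> v; rewrite lt_min => /andP[v1 v2].
rewrite (nbhs_singleton FG) h2; first exact: h1.
by rewrite /ball_ /= opprD addrA subrr sub0r normrN.
Qed.

Implicit Types p q v w I : quaternion R.

Lemma qnormM p q : qnorm (p * q) = qnorm p * qnorm q.
Proof.
rewrite /qnorm -sqrtrM; last by rewrite !addr_ge0// sqr_ge0.
by congr Num.sqrt; rewrite !qM; ring.
Qed.

Lemma norm_coord p : [/\ `|q0 p| <= `|p|, `|q1 p| <= `|p|, `|q2 p| <= `|p| & `|q3 p| <= `|p|].
Proof.
by split; rewrite [leRHS]mx_normrE; exact: (le_bigmax _ (fun ij => `|p ij.1 ij.2|) (ord0, _)).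
Qed.

Lemma qnorm_le_norm p : qnorm p <= 2 * `|p|.
Proof.
rewrite -(@ler_pXn2r _ 2)// ?nnegrE ?qnorm_ge0 ?mulr_ge0//.
have [h0 h1 h2 h3] := norm_coord p.
have S (t : R) : `|t| <= `|p| -> t ^+ 2 <= `|p| ^+ 2.
  by move=> ht; rewrite -[t ^+ 2]ger0_norm ?sqr_ge0// normrX ler_pXn2r// nnegrE.
by move: (S _ h0) (S _ h1) (S _ h2) (S _ h3); rewrite qnorm2E exprMn; lra.
Qed.

Lemma norm_le_qnorm p : `|p| <= qnorm p.
Proof.
have S (t u : R) : 0 <= u -> `|t| <= Num.sqrt (t ^+ 2 + u).
  by move=> u0; rewrite -sqrtr_sqr ler_wsqrtr// lerDl.
have sq := @sqr_ge0 R.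
rewrite [leLHS]mx_normrE; apply: bigmax_le; first exact: qnorm_ge0.
move=> -[i [[|[|[|[|//]]]] h]] _ /=; rewrite (ord1 i) (bool_irrelevance h isT) /qnorm.
- by rewrite -!addrA; apply: S; rewrite !addr_ge0.
- by rewrite addrAC -!addrA addrCA; apply: S; rewrite !addr_ge0.
- by rewrite addrAC addrC; apply: S; rewrite !addr_ge0.
- by rewrite addrC; apply: S; rewrite !addr_ge0.
Qed.

Definition imlen p : R := Num.sqrt (q1 p ^+ 2 + q2 p ^+ 2 + q3 p ^+ 2).

Lemma imlen_qim p : qnorm (qim p) = imlen p.
Proof. by rewrite /qnorm /qim !qE expr0n /= add0r. Qed.

Lemma imlen_ge0 p : 0 <= imlen p. Proof. exact: sqrtr_ge0. Qed.

Lemma imlen_le_qnorm p : imlen p <= qnorm p.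
Proof. by rewrite ler_wsqrtr//; have := sqr_ge0 (q0 p); lra. Qed.

Lemma imlen_eq0 p : imlen p = 0 -> qim p = 0.
Proof.
rewrite -imlen_qim => h; apply/eqP; rewrite -normr_eq0 eq_le normr_ge0 andbT -h.
exact: norm_le_qnorm.
Qed.

Lemma qim_scale p : imlen p *: ((imlen p)^-1 *: qim p) = qim p.
Proof.
have [h|h] := eqVneq (imlen p) 0; first by rewrite h scale0r (imlen_eq0 h).
by rewrite scalerA divff// scale1r.
Qed.

Lemma slice_decomp p : p = slice_pt ((imlen p)^-1 *: qim p) (qre p) (imlen p).
Proof.
rewrite /slice_pt qim_scale; apply: quatP; rewrite !(qD, qZ, qE, q01) /qre; ring.
Qed.

Lemma imag_unit_dir p : 0 < imlen p -> imag_unit ((imlen p)^-1 *: qim p).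
Proof.
move=> h; split; first by rewrite /qre qZ /qim qE mulr0.
have := qnormM ((imlen p)^-1 *: (1 : quaternion R)) (qim p).
rewrite qmulZl mul1r => ->; rewrite imlen_qim.
rewrite (_ : qnorm _ = (imlen p)^-1) ?mulVf ?gt_eqF//.
rewrite /qnorm !qZ !q01 !mulr0 mulr1 expr0n /= !addr0 sqrtr_sqr ger0_norm//.
by rewrite invr_ge0 imlen_ge0.
Qed.

Lemma qnorm_dir_le1 p : qnorm ((imlen p)^-1 *: qim p) <= 1.
Proof.
have := imlen_ge0 p; rewrite le_eqVlt => /orP[/eqP h|/imag_unit_dir[_ ->]//].
by rewrite -h invr0 scale0r /qnorm !q00 expr0n /= !addr0 sqrtr0.
Qed.

Lemma qim_linear : linear (@qim R).
Proof. by move=> k u v; apply: quatP; rewrite !(qD, qZ, qE); ring. Qed.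

Lemma qim_continuous : continuous (@qim R).
Proof.
move=> p; apply: quat_continuous; rewrite /prop_for /continuous_at /qim !qE;
  under eq_fun do rewrite qE.
- exact: (@cst_continuous _ _ 0 p).
- exact: coord_continuous.
- exact: coord_continuous.
- exact: coord_continuous.
Qed.

Lemma imlen_differentiable p : 0 < imlen p -> differentiable imlen p.
Proof.
rewrite sqrtr_gt0 => h.
have d1 := @is_diff_q1 R p; have d2 := @is_diff_q2 R p; have d3 := @is_diff_q3 R p.
have D := is_diffD (is_diffD (is_diffX 1 d1) (is_diffX 1 d2)) (is_diffX 1 d3).
have e : is_derive (q1 p ^+ 2 + q2 p ^+ 2 + q3 p ^+ 2) 1 Num.sqrt
  (2 * Num.sqrt (q1 p ^+ 2 + q2 p ^+ 2 + q3 p ^+ 2))^-1 by exact: is_derive1_sqrt.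
apply: (@differentiable_comp _ _ _ _ (fun p => q1 p ^+ 2 + q2 p ^+ 2 + q3 p ^+ 2) Num.sqrt).
  exact: (@ex_diff _ _ _ _ _ _ _ D).
by apply/derivable1_diffP; case: e.
Qed.

End StemDiff.

(** * From components to slice hyperholomorphic functions *)

Section StemHyper.
Variable R : realType.
Variables (F : quaternion R -> quaternion R) (al be : R * R -> quaternion R).
Hypothesis cr : forall x y : R, 0 < x -> cr_pair al be (x, y).
Hypothesis FE : forall I (x y : R), imag_unit I -> 0 < x ->
  F (slice_pt I x y) = al (x, y) + I * be (x, y).
Implicit Types p q v w I : quaternion R.

Lemma stem_parity (x y : R) : 0 < x ->
  al (x, - y) = al (x, y) /\ be (x, - y) = - be (x, y).
Proof.
move=> x0; apply: (@stem_unique _ x (- y) F) => I hI; first exact: FE.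
by rewrite slice_ptN FE ?mulrN -?mulNr//; exact: imag_unitN.
Qed.

Lemma stem_im_axis (x : R) : 0 < x -> be (x, 0) = 0.
Proof.
move=> x0; have [_] := stem_parity 0 x0; rewrite oppr0 => /eqP.
by rewrite -addr_eq0 -mulr2n -scaler_nat scaler_eq0 pnatr_eq0 => /eqP.
Qed.

Lemma stem_value p : 0 < qre p ->
  F p = al (qre p, imlen p) + ((imlen p)^-1 *: qim p) * be (qre p, imlen p).
Proof.
move=> p0; have := imlen_ge0 p; rewrite le_eqVlt => /orP[/eqP h|h]; last first.
  by rewrite {1}[p]slice_decomp FE//; exact: imag_unit_dir.
have hI := @imag_unit_exists R.
rewrite -h (stem_im_axis p0) mulr0 addr0 {1}[p]slice_decomp -h.
have E I : slice_pt I (qre p) 0 = slice_pt (quat 0 1 0 0) (qre p) 0.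
  by rewrite /slice_pt !scale0r.
by rewrite E FE// (stem_im_axis p0) mulr0 addr0.
Qed.

Lemma half_space_near p : half_space p -> \forall q \near p, half_space q.
Proof.
move=> p0; have c : q0 q @[q --> p] --> q0 p by exact: coord_continuous.
exact: (cvgr_gt _ c).
Qed.

Lemma stem_differentiable_nonreal p : half_space p -> 0 < imlen p -> differentiable F p.
Proof.
move=> p0 n0.
pose U q := ((imlen q)^-1 *: (1 : quaternion R)) * qim q.
pose G q := al (qre q, imlen q) + U q * be (qre q, imlen q).
apply: (@near_differentiable _ _ _ F G).
  near=> q; rewrite /G /U qmulZl mul1r; apply: stem_value.
  by near: q; exact: half_space_near.
have dn := imlen_differentiable n0.
have d0 : differentiable (@qre R) p by have h := @is_diff_q0 R p; exact: ex_diff.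
have dz := differentiable_pair d0 dn.
have [dal [dbe [ha hb _ _]]] := cr (imlen p) p0.
have da : differentiable (fun q => al (qre q, imlen q)) p.
  by apply: (@differentiable_comp _ _ _ _ (fun q => (qre q, imlen q)) al) => //; exact: ex_diff.
have db : differentiable (fun q => be (qre q, imlen q)) p.
  by apply: (@differentiable_comp _ _ _ _ (fun q => (qre q, imlen q)) be) => //; exact: ex_diff.
have dV : differentiable (fun q => (imlen q)^-1) p.
  by apply: (@differentiableV _ _ (@imlen R)) => //; rewrite gt_eqF.
have dZ : differentiable (fun q => (imlen q)^-1 *: (1 : quaternion R)) p.
  exact: differentiableZl.
have /differentiableP dI : differentiable (@qim R) p.
  have h := is_diff_lin p (@qim_linear R) (@qim_continuous R); exact: ex_diff.
have dU := is_diff_mulq (differentiableP dZ) dI.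
have dUB := is_diff_mulq dU (differentiableP db).
have D := is_diffD (differentiableP da) dUB.
exact: (@ex_diff _ _ _ _ _ _ _ D).
Unshelve. all: by end_near. Qed.

(** Real points need an argument of their own, because the imaginary unit
    [qim p / |qim p|] is discontinuous there.  By parity the y-derivative of [al] and
    the x-derivative of [be] vanish, so the derivative is right multiplication by
    the common value of the x-derivative of [al] and the y-derivative of [be]. *)
Lemma stem_differentiable_real p : half_space p -> imlen p = 0 -> differentiable F p.
Proof.
move=> p0 n0; have p0' : 0 < q0 p := p0.
have [dal [dbe [ha hb e1 e2]]] := cr 0 p0.
have lin_val (W : normedModType R) (f df : R * R -> W) z : is_diff z f df ->
    forall e, 0 < e -> exists2 d, 0 < d & forall s t : R, `|s| < d -> `|t| < d ->
      `|f (z + (s, t)) - f z - (s *: df (1, 0) + t *: df (0, 1))| <= e * Num.max `|s| `|t|.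
  move=> h e e0; have [d d0 hd] := diff_approx (@ex_diff _ _ _ _ _ _ _ h) e0.
  exists d => // s t hs ht; have := hd (s, t).
  by rewrite diff_partials (is_diff_val h) prod_normE /= gt_max hs ht; apply.
have z1 : dbe (1, 0) = 0.
  apply/eqP; rewrite -normr_le0; apply/ler_addgt0Pr => e e0; rewrite add0r.
  have [d d0 hd] := lin_val _ _ _ _ hb e e0.
  pose t := Num.min (d / 2) (q0 p).
  have t0 : 0 < t by rewrite lt_min p0' divr_gt0.
  have td : t < d by rewrite /t gt_min; apply/orP; left; lra.
  have := hd t 0; rewrite normr0 gtr0_norm// => /(_ td d0).
  have -> : (qre p, 0) + (t, 0) = (qre p + t, 0) :> R * R by congr pair; rewrite addr0.
  rewrite !stem_im_axis ?addr_gt0// scale0r addr0 subrr sub0r normrN normrZ.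
  by rewrite (max_idPl (ltW t0)) gtr0_norm// mulrC ler_pM2r.
rewrite z1 oppr0 in e1.
have b0 : be (qre p, 0) = 0 by exact: stem_im_axis.
pose L v := v * dal (1, 0).
apply: (@differentiable_of_eps _ _ _ F L).
- by move=> k u v; rewrite /L mulrDl qmulZl.
- by move=> v; apply: qmul_continuous; [exact: cvg_id | exact: cst_continuous].
move=> e e0.
(* the remainder of [al] counts once and that of [be] twice, each with a factor 2
   because lengths are compared with the sup norm *)
have e60 : 0 < e / 6 by rewrite divr_gt0.
have [d1 d10 h1] := lin_val _ _ _ _ ha _ e60.
have [d2 d20 h2] := lin_val _ _ _ _ hb _ e60.
(* the first bound keeps [p + v] in the half-space *)
exists (Num.min (q0 p) (Num.min d1 d2 / 2)).
  by rewrite lt_min p0' divr_gt0// lt_min d10 d20.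
move=> v; rewrite lt_min => /andP[vp vd].
have {vd} vd : 2 * `|v| < Num.min d1 d2 by lra.
have {vd} [vd1 vd2] : 2 * `|v| < d1 /\ 2 * `|v| < d2 by move: vd; rewrite lt_min => /andP[].
have [c0 _ _ _] := norm_coord v.
have nv0 := normr_ge0 v.
have n2 : imlen v <= 2 * `|v| by exact: le_trans (imlen_le_qnorm v) (qnorm_le_norm v).
have mx : Num.max `|q0 v| `|imlen v| <= 2 * `|v|.
  by rewrite ge_max (ger0_norm (imlen_ge0 v)) n2 andbT (le_trans c0)//; lra.
have pE : qim p = 0 by exact: imlen_eq0.
have imE : qim (p + v) = qim v.
  by have := qim_linear 1 p v; rewrite !scale1r pE add0r.
have nE : imlen (p + v) = imlen v by rewrite -!imlen_qim imE.
have reE : qre (p + v) = qre p + q0 v by rewrite /qre qD.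
have pos : 0 < qre (p + v).
  by rewrite reE; move: vp c0; rewrite /qre ler_norml; lra.
have s1 : `|q0 v| < d1 by rewrite (le_lt_trans c0)//; lra.
have s2 : `|q0 v| < d2 by rewrite (le_lt_trans c0)//; lra.
have t1 : `|imlen v| < d1 by rewrite ger0_norm ?imlen_ge0// (le_lt_trans n2).
have t2 : `|imlen v| < d2 by rewrite ger0_norm ?imlen_ge0// (le_lt_trans n2).
have := h1 _ _ s1 t1; have := h2 _ _ s2 t2.
have zE (s t : R) : (qre p, 0) + (s, t) = (qre p + s, t) :> R * R by congr pair; rewrite add0r.
rewrite !zE e1 z1 e2 b0 !scaler0 addr0 add0r subr0.
set w := be _ - _; set u := al _ - _ - _ => hw hu.
have -> : F (p + v) - F p - L v = u + ((imlen v)^-1 *: qim v) * w.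
  rewrite stem_value// nE imE reE (stem_value p0) n0 b0 mulr0 addr0 /u /w /L.
  have -> : v * dal (1, 0) = q0 v *: dal (1, 0) + qim v * dal (1, 0).
    have {1}-> : v = q0 v *: (1 : quaternion R) + qim v.
      by apply: quatP; rewrite !(qD, qZ, q01, qE); ring.
    by rewrite mulrDl qmulZl mul1r.
  rewrite mulrBr qmulZr -qmulZl qim_scale.
  have key (r s t a b : quaternion R) : r + s - t - (a + b) = r - t - a + (s - b).
    by rewrite opprD [r + s - t]addrAC addrACA.
  exact: key.
apply: (le_trans (ler_normD _ _)).
have hW : `|((imlen v)^-1 *: qim v) * w| <= 2 * `|w|.
  apply: le_trans (norm_le_qnorm _) _; rewrite qnormM.
  apply: le_trans (qnorm_le_norm w).
  by rewrite -[leRHS]mul1r ler_wpM2r ?qnorm_ge0// qnorm_dir_le1.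
have m1 : e / 6 * Num.max `|q0 v| `|imlen v| <= e / 6 * (2 * `|v|) by rewrite ler_pM2l.
have := le_trans hu m1; have := le_trans hw m1; move: hW.
have -> : e / 6 * (2 * `|v|) = e * `|v| / 3 by field.
lra.
Qed.

Lemma slice_hyperholomorphic_of_stem : slice_hyperholomorphic F.
Proof.
split=> [p p0|I hI x y x0].
  have := imlen_ge0 p; rewrite le_eqVlt => /orP[/eqP h|h].
    exact: stem_differentiable_real.
  exact: stem_differentiable_nonreal.
have [dal [dbe [ha hb e1 e2]]] := cr y x0.
have hG := is_diffD ha (is_diff_mulql I hb).
have h1 : is_diff x (fun t => al (t, y) + I * be (t, y)) (fun t => dal (t, 0) + I * dbe (t, 0)).
  have hp := is_diff_pair (is_diff_id x) (is_diff_cst y x).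
  exact: (@is_diff_comp _ _ _ _ (fun t => (t, y)) _ (fun z => al z + I * be z)).
have h2 : is_diff y (fun t => al (x, t) + I * be (x, t)) (fun t => dal (0, t) + I * dbe (0, t)).
  have hp := is_diff_pair (is_diff_cst x y) (is_diff_id y).
  exact: (@is_diff_comp _ _ _ _ (fun t => (x, t)) _ (fun z => al z + I * be z)).
have -> : derive1 (fun t => F (slice_pt I t y)) x = derive1 (fun t => al (t, y) + I * be (t, y)) x.
  rewrite !derive1E; apply: near_eq_derive => //.
  by near=> t; apply: FE => //; near: t; exact: lt_nbhsr.
have -> : (fun t => F (slice_pt I x t)) = (fun t => al (x, t) + I * be (x, t)).
  by apply/funext => t; exact: FE.
rewrite (derive1_is_diff h1) (derive1_is_diff h2) /= e1 e2.
rewrite mulrDr mulrA (imag_unit_sqr hI) mulN1r mulrN -opprD.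
by rewrite [_ + dal _]addrC subrr.
Unshelve. all: by end_near. Qed.

End StemHyper.

(** * Slice functions with given components *)

Section SliceFun.
Variable R : realType.
Implicit Types p q I : quaternion R.

Lemma slice_pt_surj p : exists2 I, imag_unit I & p = slice_pt I (qre p) (imlen p).
Proof.
have := imlen_ge0 p; rewrite le_eqVlt => /orP[/eqP h|h].
  exists (quat 0 1 0 0); first exact: imag_unit_exists.
  by rewrite {1}[p]slice_decomp -h /slice_pt !scale0r.
by exists ((imlen p)^-1 *: qim p); [exact: imag_unit_dir | exact: slice_decomp].
Qed.

Lemma qim_slice_pt I (x y : R) : imag_unit I -> qim (slice_pt I x y) = y *: I.
Proof.
move=> [h0 _]; have h : q0 I = 0 := h0.
by apply: quatP; rewrite /qim /slice_pt !(qE, qD, qZ, q01) ?h; ring.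
Qed.

Lemma imlen_slice_pt I (x y : R) : imag_unit I -> imlen (slice_pt I x y) = `|y|.
Proof.
move=> hI; rewrite -imlen_qim qim_slice_pt//.
by case: hI => _; rewrite /qnorm !qZ !exprMn -!mulrDr sqrtrM ?sqr_ge0// sqrtr_sqr => ->; rewrite mulr1.
Qed.

Definition slice_fun (al be : R * R -> quaternion R) p : quaternion R :=
  al (qre p, imlen p) + ((imlen p)^-1 *: qim p) * be (qre p, imlen p).

Lemma slice_funE (al be : R * R -> quaternion R) I (x y : R) :
  (forall t : R, al (x, - t) = al (x, t)) ->
  (forall t : R, be (x, - t) = - be (x, t)) ->
  imag_unit I -> slice_fun al be (slice_pt I x y) = al (x, y) + I * be (x, y).
Proof.
move=> ea ob hI.
rewrite /slice_fun qre_slice_pt// imlen_slice_pt// qim_slice_pt//.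
have [y0|y0|->] := ltgtP y 0.
- rewrite ltr0_norm// ea ob scalerA invrN mulNr mulVf ?lt_eqF//.
  by rewrite scaleN1r mulrNN.
- by rewrite gtr0_norm// scalerA mulVf ?gt_eqF// scale1r.
- have b0 : be (x, 0) = 0.
    have /eqP := ob 0; rewrite oppr0 -addr_eq0 -mulr2n -scaler_nat scaler_eq0.
    by rewrite pnatr_eq0 => /eqP.
  by rewrite normr0 b0 !mulr0.
Qed.

Lemma cr_pair_scalar (U V : R * R -> R) z : cr_pair U V z ->
  cr_pair (fun z => U z *: (1 : quaternion R)) (fun z => V z *: (1 : quaternion R)) z.
Proof.
move=> [dU [dV [u v e f]]].
have h (W dW : R * R -> R) : is_diff z W dW ->
    is_diff z (fun z => W z *: (1 : quaternion R)) (fun v => dW v *: (1 : quaternion R)).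
  move=> hW; have hs := is_diff_scalel (W z) (1 : quaternion R).
  exact: (@is_diff_comp _ _ _ _ W _ ( *:%R ^~ (1 : quaternion R))).
exists (fun v => dU v *: (1 : quaternion R)), (fun v => dV v *: (1 : quaternion R)).
by split; [exact: h|exact: h|rewrite e scaleNr|rewrite f].
Qed.

Lemma cr_pair_cst (W : normedModType R) (c : W) z : cr_pair (cst c) (cst 0) z.
Proof.
exists 0, 0; split; [exact: is_diff_cst|exact: is_diff_cst| |] => //.
by rewrite /GRing.zero /= oppr0.
Qed.

Lemma cr_pairV (U V : R * R -> R) z : U z ^+ 2 + V z ^+ 2 != 0 -> cr_pair U V z ->
  cr_pair (fun z => U z * (U z ^+ 2 + V z ^+ 2)^-1)
          (fun z => - (V z * (U z ^+ 2 + V z ^+ 2)^-1)) z.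
Proof.
move=> N0 [dU [dV [u v e f]]].
have hN := is_diffD (is_diffX 1 u) (is_diffX 1 v).
have hi : is_diff (U z ^+ 2 + V z ^+ 2) (fun t : R => t^-1) (fun h => - (U z ^+ 2 + V z ^+ 2) ^- 2 *: h).
  by apply: DiffDef; [exact: differentiable_Rinv | rewrite diff_Rinv].
have hNi : is_diff z (fun z => (U z ^+ 2 + V z ^+ 2)^-1) _ := is_diff_comp hN hi.
have h1 := is_diffM u hNi; have h2 := is_diffN (is_diffM v hNi).
eexists; eexists; split; [exact: h1|exact: h2| |];
  rewrite !fctE /GRing.scale /= e f; field; exact: N0.
Qed.

End SliceFun.

(** * Components of the Blaschke factor *)

Section Blaschke.
Variable R : realType.
Variable a : quaternion R.
Hypothesis ha : half_space a.

Local Notation u := (q0 a).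
Local Notation one := (1 : quaternion R).
Local Notation V := (q1 a ^+ 2 + q2 a ^+ 2 + q3 a ^+ 2).

Lemma re_gt0 : 0 < u. Proof. exact: ha. Qed.

(** real and imaginary parts of [z^2 + 2 Re(a) z + |a|^2] for [z = x + i y] *)
Definition den_re (z : R * R) : R := (z.1 + u) ^+ 2 - z.2 ^+ 2 + V.
Definition den_im (z : R * R) : R := 2 * (z.1 + u) * z.2.
Definition den_norm z : R := den_re z ^+ 2 + den_im z ^+ 2.

Definition inv_re z : R := den_re z * (den_norm z)^-1.
Definition inv_im z : R := - (den_im z * (den_norm z)^-1).

Lemma imsq_ge0 : 0 <= V. Proof. by rewrite !addr_ge0// sqr_ge0. Qed.

Lemma den_norm_gt0 z : - u < z.1 -> 0 < den_norm z.
Proof.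
move=> hz; rewrite lt_neqAle addr_ge0 ?sqr_ge0// andbT eq_sym.
have X0 : 0 < z.1 + u by lra.
rewrite /den_norm paddr_eq0 ?sqr_ge0// !sqrf_eq0; apply/negP => /andP[h1].
rewrite /den_im !mulf_eq0 pnatr_eq0 (gt_eqF X0) /= => /eqP h2.
move: h1; rewrite /den_re h2 expr0n subr0 gt_eqF//.
by apply: ltr_pwDl; [exact: exprn_gt0 | exact: imsq_ge0].
Qed.

Lemma inv_mul z : - u < z.1 ->
  inv_re z * den_re z - inv_im z * den_im z = 1 /\
  inv_re z * den_im z + inv_im z * den_re z = 0.
Proof.
move=> hz; have := den_norm_gt0 hz; rewrite /inv_re /inv_im => N0.
split; last by ring.
have e : den_re z * (den_norm z)^-1 * den_re z - - (den_im z * (den_norm z)^-1) * den_im z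
  = (den_norm z)^-1 * den_norm z by rewrite [in X in _ = _ * X]/den_norm; ring.
by rewrite e mulVf// gt_eqF.
Qed.

Lemma inv_norm z : - u < z.1 -> (inv_re z ^+ 2 + inv_im z ^+ 2) * den_norm z = 1.
Proof.
move=> hz; have := den_norm_gt0 hz; rewrite /inv_re /inv_im => N0.
have e : ((den_re z * (den_norm z)^-1) ^+ 2 + (- (den_im z * (den_norm z)^-1)) ^+ 2)
  = (den_norm z)^-1 ^+ 2 * den_norm z by rewrite [in X in _ = _ * X]/den_norm; ring.
by rewrite e; field; rewrite gt_eqF.
Qed.

Lemma cr_pair_inv z : - u < z.1 -> cr_pair inv_re inv_im z.
Proof.
move=> hz; have h1 := cr_pair_linear 1 0 (- u, 0) z.
have h := cr_pairD (cr_pairM_real h1 h1) (cr_pair_cst V z).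
have h' : cr_pair den_re den_im z.
  move: h; congr cr_pair; apply/funext => w; rewrite /den_re /den_im /=; ring.
by apply: (cr_pairV _ h'); rewrite gt_eqF//; exact: den_norm_gt0.
Qed.

(** components of [(z^2 + 2 Re(a) z + |a|^2)^-1 (z + a)], the star
    inverse of [p + conj a] *)
Definition ginv_re (z : R * R) : quaternion R :=
  (inv_re z *: one) * (z.1 *: one + a) - (inv_im z *: one) * (z.2 *: one).
Definition ginv_im (z : R * R) : quaternion R :=
  (inv_re z *: one) * (z.2 *: one) + (inv_im z *: one) * (z.1 *: one + a).

Lemma cr_pair_shift (c : quaternion R) z :
  cr_pair (fun z : R * R => z.1 *: (1 : quaternion R) + c) (fun z => z.2 *: one) z.
Proof.
have h := cr_pairD (cr_pair_scalar (cr_pair_linear 1 0 (0, 0) z)) (cr_pair_cst c z).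
move: h; congr cr_pair; apply/funext => w /=; rewrite !(subr0, mul0r, mul1r, addr0)//.
Qed.

Lemma cr_pair_ginv z : - u < z.1 -> cr_pair ginv_re ginv_im z.
Proof.
move=> hz.
exact: (cr_pairM_quat (cr_pair_scalar (cr_pair_inv hz)) (cr_pair_shift a z)).
Qed.

Lemma ginv_linear (x y : R) :
  ginv_re (x, y) = inv_re (x, y) *: (x *: one + a) - (inv_im (x, y) * y) *: one /\
  ginv_im (x, y) = (inv_re (x, y) * y) *: one + inv_im (x, y) *: (x *: one + a).
Proof. by rewrite /ginv_re /ginv_im /= !qmulZl !mul1r !scalerA. Qed.

Lemma shift_conj (x : R) :
  (x *: one + qconj a) * (x *: one + a) = ((x + u) ^+ 2 + V) *: one /\
  (x *: one + a) * (x *: one + qconj a) = ((x + u) ^+ 2 + V) *: one.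
Proof.
by split; apply: quatP; rewrite qM !qD !qZ !q01 /qconj !qE; ring.
Qed.

Lemma shift_add (x : R) : x *: one + qconj a = (2 * (x + u)) *: one - (x *: one + a).
Proof. by apply: quatP; rewrite !(qD, qN, qZ) !q01 /qconj !qE; ring. Qed.

(** The identity [(z + conj a) * (z + a) = z^2 + 2 Re(a) z + |a|^2], in components
    and after division: once the products of [A] and [B] are known to be real
    everything is linear in them. *)
Lemma scalar_combo (A B : quaternion R) (r s y S n : R) : B = S *: one - A ->
  r * (n - y ^+ 2) - s * (S * y) = 1 -> r * (S * y) + s * (n - y ^+ 2) = 0 ->
  (r * n) *: one - (s * y) *: B - ((r * y * y) *: one + (s * y) *: A) = 1 /\
  ((r * y) *: B + (s * n) *: one) + ((r * y) *: A - (s * y * y) *: one) = 0.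
Proof.
move=> -> E1 E2; split.
  rewrite -[RHS]scale1r -E1.
  by apply: quatP; rewrite !(qD, qN, qZ) !q01; ring.
rewrite -[RHS](scale0r one) -E2.
by apply: quatP; rewrite !(qD, qN, qZ) !q01; ring.
Qed.

Lemma ginv_left (x y : R) : - u < x ->
  (x *: one + qconj a) * ginv_re (x, y) - (y *: one) * ginv_im (x, y) = 1 /\
  (x *: one + qconj a) * ginv_im (x, y) + (y *: one) * ginv_re (x, y) = 0.
Proof.
move=> hx; have [] := @inv_mul (x, y) hx; have [-> ->] := ginv_linear x y.
rewrite /den_re /den_im /=; move: (inv_re _) (inv_im _) => r s E1 E2.
have [c1 c2] := shift_conj x.
rewrite !(mulrBr, mulrDr) !qmulZr !qmulZl !mulr1 !mul1r c1 !scalerA.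
have := @scalar_combo (x *: one + a) (x *: one + qconj a) r s y (2 * (x + u)) ((x + u) ^+ 2 + V) (shift_add x).
case; [by rewrite -[RHS]E1; ring | by rewrite -[RHS]E2; ring |].
by [].
Qed.

Lemma ginv_right (x y : R) : - u < x ->
  ginv_re (x, y) * (x *: one + qconj a) - ginv_im (x, y) * (y *: one) = 1 /\
  ginv_re (x, y) * (y *: one) + ginv_im (x, y) * (x *: one + qconj a) = 0.
Proof.
move=> hx; have [] := @inv_mul (x, y) hx; have [-> ->] := ginv_linear x y.
rewrite /den_re /den_im /=; move: (inv_re _) (inv_im _) => r s E1 E2.
have [c1 c2] := shift_conj x.
rewrite !(mulrBl, mulrDl) !qmulZr !qmulZl !mulr1 !mul1r c2 !scalerA.
have := @scalar_combo (x *: one + a) (x *: one + qconj a) r s y (2 * (x + u)) ((x + u) ^+ 2 + V) (shift_add x).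
case; [by rewrite -[RHS]E1; ring | by rewrite -[RHS]E2; ring |].
by move=> F1 F2; rewrite ![y * _]mulrC [X in _ /\ X = _]addrC; split.
Qed.

Lemma ginv_parity (x y : R) :
  ginv_re (x, - y) = ginv_re (x, y) /\ ginv_im (x, - y) = - ginv_im (x, y).
Proof.
have dr : den_re (x, - y) = den_re (x, y) by rewrite /den_re /= sqrrN.
have di : den_im (x, - y) = - den_im (x, y) by rewrite /den_im /= mulrN.
have dn : den_norm (x, - y) = den_norm (x, y) by rewrite /den_norm dr di sqrrN.
have r : inv_re (x, - y) = inv_re (x, y) by rewrite /inv_re dn dr.
have i : inv_im (x, - y) = - inv_im (x, y) by rewrite /inv_im dn di mulNr.
by rewrite /ginv_re /ginv_im r i /= !scaleNr !mulrN !mulNr opprK opprD.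
Qed.

Lemma shiftE (c I : quaternion R) (x y : R) :
  slice_pt I x y + c = (x *: one + c) + I * (y *: one).
Proof. by rewrite /slice_pt qmulZr mulr1 addrAC. Qed.

Lemma ginv_is_star_inverse :
  is_star_inverse (fun p => p + qconj a) (slice_fun ginv_re ginv_im).
Proof.
have u0 := re_gt0.
have gE I (x y : R) : imag_unit I -> 0 < x -> slice_fun ginv_re ginv_im (slice_pt I x y)
    = ginv_re (x, y) + I * ginv_im (x, y).
  by move=> hI x0; apply: slice_funE => // t; case: (ginv_parity x t).
split.
  apply: (@slice_hyperholomorphic_of_stem _ _ ginv_re ginv_im) => // x y x0.
  by apply: cr_pair_ginv => /=; lra.
move=> p p0; have [I hI ->] := slice_pt_surj p.
have x0 : - u < qre p by move: p0; rewrite /half_space /=; lra.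
have sE I' (s t : R) : imag_unit I' -> 0 < s ->
    slice_pt I' s t + qconj a = (s *: one + qconj a) + I' * (t *: one) by move=> *; exact: shiftE.
rewrite (starE (al := fun x y => x *: one + qconj a) (be := fun x y => y *: one)
  (ga := fun x y => ginv_re (x, y)) (de := fun x y => ginv_im (x, y)) sE gE)//.
rewrite (starE (ga := fun x y => x *: one + qconj a) (de := fun x y => y *: one)
  (al := fun x y => ginv_re (x, y)) (be := fun x y => ginv_im (x, y)) gE sE)//.
have [-> ->] := ginv_left (imlen p) x0; have [-> ->] := ginv_right (imlen p) x0.
by rewrite mulr0 addr0.
Qed.

(** Although [star_inv] is only a choice, its components are determined: the
    product of stems is associative, so a right inverse equals a left one. *)
Lemma star_inv_stem I (x y : R) : imag_unit I -> 0 < x ->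
  star_inv (fun p => p + qconj a) (slice_pt I x y) = ginv_re (x, y) + I * ginv_im (x, y).
Proof.
set G := star_inv _.
have [hG hs] : is_star_inverse (fun p => p + qconj a) G.
  by apply: (@xgetPex _ (fun=> 0) [set g | is_star_inverse _ g]); eexists; exact: ginv_is_star_inverse.
move=> hI x0; have u0 := re_gt0; have rep := representation hG.
rewrite rep//.
have sE I' (s t : R) : imag_unit I' -> 0 < s ->
    slice_pt I' s t + qconj a = (s *: one + qconj a) + I' * (t *: one) by move=> *; exact: shiftE.
have key I' : imag_unit I' ->
   1 = ((x *: one + qconj a) * stem_re G (x, y) - (y *: one) * stem_im G (x, y))
     + I' * ((x *: one + qconj a) * stem_im G (x, y) + (y *: one) * stem_re G (x, y)).
  move=> hI'; have hp : half_space (slice_pt I' x y) by rewrite /half_space /= qre_slice_pt.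
  rewrite -[LHS](hs _ hp).1.
  by rewrite (starE (al := fun x y => x *: one + qconj a) (be := fun x y => y *: one)
    (ga := fun x y => stem_re G (x, y)) (de := fun x y => stem_im G (x, y)) sE rep).
have [E1 E2] := @stem_unique _ x y (fun=> 1) 1 0 _ _ (fun I' _ => esym (etrans (congr1 _ (mulr0 I')) (addr0 1))) key.
have ux : - u < x by lra.
have [F1 F2] := ginv_right y ux.
have assoc (g d A B c e : quaternion R) :
    (g * A - d * B) * c - (g * B + d * A) * e = g * (A * c - B * e) - d * (A * e + B * c).
  rewrite mulrBl mulrDl mulrBr mulrDr !mulrA opprD addrACA -opprD.
  by rewrite [X in _ - X]addrC.
have assoc' (g d A B c e : quaternion R) :
    (g * A - d * B) * e + (g * B + d * A) * c = g * (A * e + B * c) + d * (A * c - B * e).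
  rewrite mulrBl mulrDl mulrBr mulrDr !mulrA addrACA.
  by rewrite [X in _ + X]addrC.
congr (_ + _ * _).
  have := assoc (ginv_re (x, y)) (ginv_im (x, y)) (x *: one + qconj a) (y *: one) (stem_re G (x, y)) (stem_im G (x, y)).
  by rewrite F1 F2 -E1 -E2 mul1r mul0r mulr1 mulr0 !subr0.
have := assoc' (ginv_re (x, y)) (ginv_im (x, y)) (x *: one + qconj a) (y *: one) (stem_re G (x, y)) (stem_im G (x, y)).
by rewrite F1 F2 -E1 -E2 mul1r mul0r mulr1 mulr0 addr0 add0r.
Qed.

Definition bl_re (z : R * R) : quaternion R :=
  ginv_re z * (z.1 *: one - a) - ginv_im z * (z.2 *: one).
Definition bl_im (z : R * R) : quaternion R :=
  ginv_re z * (z.2 *: one) + ginv_im z * (z.1 *: one - a).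

Lemma blaschke_stem I (x y : R) : imag_unit I -> 0 < x ->
  blaschke a (slice_pt I x y) = bl_re (x, y) + I * bl_im (x, y).
Proof.
have sE I' (s t : R) : imag_unit I' -> 0 < s ->
    slice_pt I' s t - a = (s *: one - a) + I' * (t *: one) by move=> *; exact: shiftE.
exact: (starE (ga := fun x y => x *: one - a) (de := fun x y => y *: one)
    (al := fun x y => ginv_re (x, y)) (be := fun x y => ginv_im (x, y)) star_inv_stem sE).
Qed.

Lemma cr_pair_bl z : - u < z.1 -> cr_pair bl_re bl_im z.
Proof. by move=> hz; exact: (cr_pairM_quat (cr_pair_ginv hz) (cr_pair_shift (- a) z)). Qed.

Definition qsq (p : quaternion R) : R := q0 p ^+ 2 + q1 p ^+ 2 + q2 p ^+ 2 + q3 p ^+ 2.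

(** components of the numerator [z^2 - a^2] *)
Definition num_re (z : R * R) : quaternion R := (z.1 ^+ 2 - z.2 ^+ 2) *: one - a * a.
Definition num_im (z : R * R) : R := 2 * z.1 * z.2.

Lemma bl_quotient z : bl_re z = inv_re z *: num_re z - (inv_im z * num_im z) *: one /\
  bl_im z = (inv_re z * num_im z) *: one + inv_im z *: num_re z.
Proof.
case: z => x y; rewrite /bl_re /bl_im; have [-> ->] := ginv_linear x y.
rewrite /num_re /num_im /=; move: (inv_re _) (inv_im _) => r s.
have c : (x *: one + a) * (x *: one - a) = (x ^+ 2) *: one - a * a.
  by rewrite mulrDl !mulrBr !qmulZl !qmulZr !mulr1 !mul1r scalerA addrA subrK expr2.
rewrite !(mulrBl, mulrDl) !qmulZr !qmulZl !mulr1 !mul1r c !scalerA.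
by split; apply: quatP; rewrite !(qD, qN, qZ) !q01; ring.
Qed.

(** The factor is contractive on the half-plane: the gap between squared
    denominator and numerator is [4 x Re(a) ((x + Re(a))^2 + y^2 + |Im a|^2)]. *)
Lemma bl_le1 z : 0 <= z.1 -> qsq (bl_re z) + qsq (bl_im z) <= 1.
Proof.
move=> z0; have u0 := re_gt0; have hz : - u < z.1 by lra.
have [-> ->] := bl_quotient z; have iN := inv_norm hz; rewrite -iN.
have -> : qsq (inv_re z *: num_re z - (inv_im z * num_im z) *: one)
  + qsq ((inv_re z * num_im z) *: one + inv_im z *: num_re z)
  = (inv_re z ^+ 2 + inv_im z ^+ 2) * (qsq (num_re z) + num_im z ^+ 2).
  by rewrite /qsq !(qD, qN, qZ, q01); ring.
rewrite ler_wpM2l ?addr_ge0 ?sqr_ge0// -subr_ge0.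
have -> : den_norm z - (qsq (num_re z) + num_im z ^+ 2)
  = 4 * z.1 * u * ((z.1 + u) ^+ 2 + z.2 ^+ 2 + V).
  by rewrite /den_norm /den_re /den_im /qsq /num_re /num_im !(qD, qN, qZ, qM, q01); ring.
have V0 := imsq_ge0.
by rewrite !mulr_ge0 ?(ltW u0)// !addr_ge0// ?sqr_ge0.
Qed.

(** On the boundary [z^2] is real, so the numerator [z^2 - a^2] has no second
    component and the factor is [(r + i s) m] with [r], [s] real: its components
    are the real multiples [r m] and [s m] of one quaternion.  The cross terms
    in the squared moduli therefore cancel. *)
Lemma bl_boundary y (al be : quaternion R) :
  qsq (bl_re (0, y) * al - bl_im (0, y) * be) + qsq (bl_re (0, y) * be + bl_im (0, y) * al)
  = qsq al + qsq be.
Proof.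
have u0 := re_gt0; have hz : - u < (0, y).1 by rewrite /=; lra.
have [-> ->] := bl_quotient (0, y); have iN := inv_norm hz.
have n0 : num_im (0, y) = 0 by rewrite /num_im /= mulr0 mul0r.
rewrite n0 !mulr0 scale0r subr0 add0r.
have D : den_norm (0, y) = qsq (num_re (0, y)).
  by rewrite /den_norm /den_re /den_im /qsq /num_re /num_im !(qD, qN, qZ, qM, q01) /=; ring.
rewrite -[RHS]mul1r -iN D; move: (num_re _) (inv_re _) (inv_im _) => m r s.
by rewrite /qsq !(qD, qN, qM, qZ); ring.
Qed.

End Blaschke.

(** * Squared moduli and integrals *)

Section Norms.
Variable R : realType.
Implicit Types (p q I : quaternion R) (f g : quaternion R -> quaternion R).

Lemma qsqE p : qnorm p ^+ 2 = qsq p. Proof. exact: qnorm2E. Qed.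

Lemma qsqM p q : qsq (p * q) = qsq p * qsq q.
Proof. by rewrite -!qsqE qnormM exprMn. Qed.

Lemma qsq_ge0 p : 0 <= qsq p. Proof. by rewrite -qsqE sqr_ge0. Qed.

Lemma qsq_unit I : imag_unit I -> qsq I = 1.
Proof. by move=> [_ h]; rewrite -qsqE h expr1n. Qed.

Lemma qsq_parallelogram p q : qsq (p + q) + qsq (p - q) = 2 * (qsq p + qsq q).
Proof. by rewrite /qsq !(qD, qN); ring. Qed.

Lemma qsqD_le p q : qsq (p + q) <= 2 * (qsq p + qsq q).
Proof. by rewrite -qsq_parallelogram lerDl qsq_ge0. Qed.

Lemma qsqB_le p q : qsq (p - q) <= 2 * (qsq p + qsq q).
Proof. by rewrite -qsq_parallelogram lerDr qsq_ge0. Qed.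

(** The cross term of the two components has opposite signs on the slices of [I]
    and [- I]. *)
Lemma qsq_slices I p q : imag_unit I ->
  qsq (p + I * q) + qsq (p + - I * q) = 2 * (qsq p + qsq q).
Proof. by move=> hI; rewrite mulNr qsq_parallelogram qsqM (qsq_unit hI) mul1r. Qed.

(** components read off from the values [p], [q] on the slices of [I] and [- I] *)
Definition comp_re (p q : quaternion R) : quaternion R := (2^-1 : R) *: (p + q).
Definition comp_im I (p q : quaternion R) : quaternion R := (2^-1 : R) *: (I * (q - p)).

Lemma comp_slices I (al be : quaternion R) : imag_unit I ->
  comp_re (al + I * be) (al + - I * be) = al /\
  comp_im I (al + I * be) (al + - I * be) = be.
Proof.
move=> hI; have half p : (2^-1 : R) *: (p + p) = p.
  by rewrite scalerDr -scalerDl (_ : 2^-1 + 2^-1 = 1 :> R) ?scale1r//; field.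
split; first by rewrite /comp_re mulNr addrACA subrr addr0 half.
rewrite /comp_im mulNr opprD addrACA subrr add0r -opprD mulrN mulrDr mulrA.
by rewrite (imag_unit_sqr hI) mulN1r opprD opprK half.
Qed.

Lemma comp_inv I p q : imag_unit I -> comp_re p q + I * comp_im I p q = p /\
  comp_re p q + - I * comp_im I p q = q.
Proof.
move=> hI; have half r : (2^-1 : R) *: (r + r) = r.
  by rewrite scalerDr -scalerDl (_ : 2^-1 + 2^-1 = 1 :> R) ?scale1r//; field.
rewrite /comp_re /comp_im mulNr qmulZr mulrA (imag_unit_sqr hI) mulN1r opprB.
rewrite -scalerBr -scalerDr; split.
  by rewrite addrACA subrr addr0 half.
by rewrite opprB addrC addrA subrK half.
Qed.

End Norms.

Section NonMeasurable.
Context d (T : measurableType d) (R : realType) (mu : {measure set T -> \bar R}).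
Local Open Scope ereal_scope.

Lemma ge0_integral_mono (f g : T -> \bar R) : (forall x, 0 <= f x) ->
  (forall x, f x <= g x) -> \int[mu]_x f x <= \int[mu]_x g x.
Proof.
move=> f0 fg; have g0 x : 0 <= g x by exact: le_trans (f0 x) (fg x).
rewrite !ge0_integralTE//; apply: ereal_sup_le => _ [h hf <-].
by exists h => // x; exact: le_trans (hf x) (fg x).
Qed.

(** The integral of a nonnegative function is a supremum over simple functions
    below it, whether or not it is measurable, so it can be squeezed between
    two measurable functions that differ on a null set only. *)
Lemma ge0_integral_ae (f g : T -> \bar R) : (forall x, 0 <= f x) ->
  (forall x, 0 <= g x) -> measurable_fun [set: T] g ->
  {ae mu, forall x, f x = g x} -> \int[mu]_x f x = \int[mu]_x g x.
Proof.
move=> f0 g0 mg [N [mN N0 subN]].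
have mb : measurable_fun [set: T] (fun x => x \in N).
  apply: (measurable_fun_bool true); rewrite setTI (_ : _ @^-1` _ = N)//.
  by apply/seteqP; split=> x /=; [exact: set_mem | exact: mem_set].
pose lo x := if x \in N then 0 else g x.
pose hi x := if x \in N then +oo else g x.
have mlo : measurable_fun [set: T] lo by apply: measurable_fun_ifT => //; exact: measurable_cst.
have mhi : measurable_fun [set: T] hi by apply: measurable_fun_ifT => //; exact: measurable_cst.
have lo0 x : 0 <= lo x by rewrite /lo; case: ifP.
have hi0 x : 0 <= hi x by rewrite /hi; case: ifP => // _; exact: leey.
have off x : x \notin N -> f x = g x.
  by move=> xN; apply: contrapT => h; move/negP: xN; apply; rewrite inE; exact: subN.
have elo : \int[mu]_x lo x = \int[mu]_x g x.
  apply: ge0_ae_eq_integral => //; exists N; split => // x /= h.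
  by apply: contrapT => xN; apply: h => _; rewrite /lo memNset.
have ehi : \int[mu]_x hi x = \int[mu]_x g x.
  apply: ge0_ae_eq_integral => //; exists N; split => // x /= h.
  by apply: contrapT => xN; apply: h => _; rewrite /hi memNset.
apply/eqP; rewrite eq_le; apply/andP; split; [rewrite -ehi|rewrite -elo];
  apply: ge0_integral_mono => // x.
  by rewrite /hi; case: ifPn => [_|/off->//]; exact: leey.
by rewrite /lo; case: ifPn => [//|/off->].
Qed.
End NonMeasurable.

Section Reflection.
Context (R : realType).
Local Open Scope ereal_scope.
Local Notation mu := (@lebesgue_measure R).
Lemma ge0_integral_oppr (f : R -> \bar R) : measurable_fun setT f ->
  (forall x, 0 <= f x) -> \int[mu]_x f (- x)%R = \int[mu]_x f x.
Proof.
move=> mf f0.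
transitivity (\int[pushforward mu (-%R : _ -> measurableTypeR R)]_x f x).
  by rewrite ge0_integral_pushforward//= preimage_setT.
by apply: eq_measure_integral => //= A mA _; exact: lebesgue_measureN.
Qed.
End Reflection.

(** * Boundary values and boundary energy *)

Section BoundaryValues.
Variable R : realType.
Implicit Types (I l : quaternion R) (f g : quaternion R -> quaternion R).
Local Notation mu := (@lebesgue_measure R).

Lemma ae_mono (P Q : R -> Prop) : (forall y, P y -> Q y) ->
  {ae mu, forall y, P y} -> {ae mu, forall y, Q y}.
Proof. by move=> PQ; apply: (@filterS _ _ (ae_filter_ringOfSetsType mu)). Qed.

Lemma ae_and (P Q : R -> Prop) : {ae mu, forall y, P y} ->
  {ae mu, forall y, Q y} -> {ae mu, forall y, P y /\ Q y}.
Proof. by move=> hP hQ; apply: (@filterI _ _ (ae_filter_ringOfSetsType mu)). Qed.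

(** The horizontal segment ending at [I y] lies in every cone. *)
Lemma nt_limit_seq f I (y : R) l : nt_limit f I y l ->
  f (slice_pt I (n.+1%:R^-1) y) @[n --> \oo] --> l.
Proof.
move=> /(_ 1 ltr01) h.
apply: (@cvg_comp _ _ _ (fun n => ((n.+1%:R^-1 : R), y)) (fun z => f (slice_pt I z.1 z.2)) \oo _ _ _ h).
have c : ((n.+1%:R^-1 : R), y) @[n --> \oo] --> ((0 : R), y).
  apply: (@cvg_pair _ _ _ \oo (nbhs (0 : R)) (nbhs y)); last exact: cvg_cst.
  exact: (@cvg_harmonic R).
move=> P /= hP.
have := c (fun z : R * R => 0 < z.1 /\ `|z.2 - y| < 1 * z.1 -> P z) hP.
rewrite /= !nbhs_simpl /=; apply: filterS => n; apply.
by rewrite subrr normr0 mul1r invr_gt0 ltr0n.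
Qed.

Lemma nt_limit_uniq f I (y : R) l l' : nt_limit f I y l -> nt_limit f I y l' -> l = l'.
Proof.
move=> /nt_limit_seq h /nt_limit_seq h'; apply: (cvg_unique _ h h').
exact: (@norm_hausdorff R (quaternion R)).
Qed.

Lemma bdry_val f I (y : R) l : nt_limit f I y l -> bdry f I y = l.
Proof.
move=> h; rewrite /bdry; case: xgetP => [l' _ h'|/(_ l)]; last by [].
exact: nt_limit_uniq h' h.
Qed.

Lemma qsq_continuous : continuous (@qsq R).
Proof.
move=> p; apply: differentiable_continuous.
have D := is_diffD (is_diffD (is_diffD (is_diffX 1 (is_diff_q0 p))
  (is_diffX 1 (is_diff_q1 p))) (is_diffX 1 (is_diff_q2 p))) (is_diffX 1 (is_diff_q3 p)).
exact: (@ex_diff _ _ _ _ _ _ _ D).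
Qed.

Lemma qsq_slice_measurable f I (x : R) : slice_hyperholomorphic f -> imag_unit I -> 0 < x ->
  measurable_fun [set: R] (fun y => (qsq (f (slice_pt I x y)))%:E).
Proof.
move=> hf hI x0; apply/measurable_EFinP; apply: continuous_measurable_fun => y.
have [dF h _] := slice_restriction y hf hI x0.
have hp := is_diff_pair (is_diff_cst x y) (is_diff_id y).
have hc : is_diff y (fun t => f (slice_pt I x t)) _ :=
  @is_diff_comp _ _ _ _ (fun t => (x, t)) _ (fun z => f (slice_pt I z.1 z.2)) _ _ hp h.
apply: (@continuous_comp _ _ _ (fun t => f (slice_pt I x t)) (@qsq R)); last exact: qsq_continuous.
by apply: differentiable_continuous; exact: ex_diff.
Qed.

Local Open Scope ereal_scope.

(** A Borel function of [y], defined by means of countably many vertical lines,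
    that is [|f(I y)|^2] wherever the nontangential limit exists. *)
Definition bdry_sq f I (y : R) : \bar R :=
  limn_esup (fun n => (qsq (f (slice_pt I (n.+1%:R^-1) y)))%:E).

Lemma bdry_sq_val f I (y : R) l : nt_limit f I y l -> bdry_sq f I y = (qsq l)%:E.
Proof.
move=> /nt_limit_seq h; rewrite /bdry_sq.
have c : (qsq (f (slice_pt I (n.+1%:R^-1) y)))%:E @[n --> \oo] --> (qsq l)%:E.
  apply: cvg_EFin; first exact: nearW.
  apply: (@cvg_comp _ _ _ (fun n => f (slice_pt I (n.+1%:R^-1) y)) (@qsq R) \oo _ _ h).
  exact: qsq_continuous.
by have [_ ->] := cvg_limn_einf_sup c.
Qed.

Lemma bdry_sq_ge0 f I (y : R) : 0 <= bdry_sq f I y.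
Proof.
rewrite /bdry_sq limn_esup_lim; apply: lime_ge; first exact: is_cvg_esups.
near=> n; apply: le_trans (ereal_sup_ubound _); last by exists n => /=.
by rewrite lee_fin qsq_ge0.
Unshelve. all: by end_near. Qed.

Lemma bdry_sq_measurable f I : slice_hyperholomorphic f -> imag_unit I ->
  measurable_fun [set: R] (bdry_sq f I).
Proof.
move=> hf hI; apply: measurable_fun_limn_esup => n.
exact: qsq_slice_measurable.
Qed.

Lemma bdry_sq_opp f I (y : R) : bdry_sq f (- I)%R y = bdry_sq f I (- y)%R.
Proof. by rewrite /bdry_sq; congr limn_esup; apply/funext => n; rewrite slice_ptN. Qed.

Definition ae_nt_limits f := forall I, imag_unit I ->
  {ae mu, forall y, exists l, nt_limit f I y l}.

Lemma bdry_energyE f I : slice_hyperholomorphic f -> ae_nt_limits f -> imag_unit I ->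
  bdry_energy f I = \int[mu]_y bdry_sq f I y.
Proof.
move=> hf hl hI; rewrite /bdry_energy; apply: ge0_integral_ae.
- by move=> y; rewrite lee_fin sqr_ge0.
- exact: bdry_sq_ge0.
- exact: bdry_sq_measurable.
apply: ae_mono (hl I hI) => y [l h].
by rewrite (bdry_val h) (bdry_sq_val h) qsqE.
Qed.

(** Since [y] runs over the whole line, the slices of [I] and [- I] have the
    same boundary energy, hence twice the energy is the integral of a quantity
    in which the cross term of the two components has cancelled. *)
Lemma bdry_energy_sym f I : slice_hyperholomorphic f -> ae_nt_limits f -> imag_unit I ->
  2%:E * bdry_energy f I = \int[mu]_y (bdry_sq f I y + bdry_sq f (- I)%R y).
Proof.
move=> hf hl hI; have hI' := imag_unitN hI.
have m1 := bdry_sq_measurable hf hI; have m2 := bdry_sq_measurable hf hI'.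
rewrite ge0_integralD; first last.
- exact: m2.
- by move=> y _; exact: bdry_sq_ge0.
- exact: m1.
- by move=> y _; exact: bdry_sq_ge0.
- exact: measurableT.
rewrite (bdry_energyE hf hl hI).
have -> : \int[mu]_y bdry_sq f (- I)%R y = \int[mu]_y bdry_sq f I y.
  under eq_integral do rewrite bdry_sq_opp.
  by apply: (ge0_integral_oppr m1) => y; exact: bdry_sq_ge0.
by rewrite -[2%R]/(1 + 1)%R EFinD ge0_muleDl ?mul1e.
Qed.

Lemma double_inj (x y : \bar R) : 2%:E * x = 2%:E * y -> x = y.
Proof.
have mono := @lee_pmul2l R 2%:E isT (ltr0n R 2).
by move=> e; apply: le_anti; apply/andP; split; rewrite -mono e.
Qed.

Lemma bdry_energy_eq f g I : imag_unit I ->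
  slice_hyperholomorphic f -> ae_nt_limits f ->
  slice_hyperholomorphic g -> ae_nt_limits g ->
  {ae mu, forall y, bdry_sq g I y + bdry_sq g (- I)%R y = bdry_sq f I y + bdry_sq f (- I)%R y} ->
  bdry_energy g I = bdry_energy f I.
Proof.
move=> hI hf lf hg lg h; have hI' := imag_unitN hI.
suff : 2%:E * bdry_energy g I = 2%:E * bdry_energy f I by exact: double_inj.
have e1 := bdry_energy_sym hg lg hI; have e2 := bdry_energy_sym hf lf hI.
apply: (etrans e1); apply: (etrans _ (esym e2)); apply: ge0_ae_eq_integral.
- exact: measurableT.
- by apply: emeasurable_funD; exact: bdry_sq_measurable.
- by apply: emeasurable_funD; exact: bdry_sq_measurable.
- by move=> y _; apply: adde_ge0; exact: bdry_sq_ge0.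
- by move=> y _; apply: adde_ge0; exact: bdry_sq_ge0.
by apply: ae_mono h => y e _.
Qed.

End BoundaryValues.

(** * Multiplication by the Blaschke factor *)

Section Multiplication.
Variable R : realType.
Variable a : quaternion R.
Hypothesis ha : half_space a.
Implicit Types (I l : quaternion R) (f g : quaternion R -> quaternion R).
Local Notation mu := (@lebesgue_measure R).
Local Notation M f := (star (blaschke a) f).

Definition prod_re f z : quaternion R := bl_re a z * stem_re f z - bl_im a z * stem_im f z.
Definition prod_im f z : quaternion R := bl_re a z * stem_im f z + bl_im a z * stem_re f z.

Lemma star_blaschkeE f : slice_hyperholomorphic f -> forall I (x y : R), imag_unit I -> 0 < x ->
  M f (slice_pt I x y) = prod_re f (x, y) + I * prod_im f (x, y).
Proof.
move=> hf; exact: (starE (al := fun x y => bl_re a (x, y)) (be := fun x y => bl_im a (x, y))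
  (ga := fun x y => stem_re f (x, y)) (de := fun x y => stem_im f (x, y))
  (blaschke_stem ha) (representation hf)).
Qed.

Lemma star_blaschke_hyper f : slice_hyperholomorphic f -> slice_hyperholomorphic (M f).
Proof.
move=> hf; apply: (@slice_hyperholomorphic_of_stem _ _ (prod_re f) (prod_im f)).
  move=> x y x0; apply: cr_pairM_quat; last exact: stem_cr_pair.
  by apply: cr_pair_bl => //=; have : 0 < q0 a := ha; lra.
exact: star_blaschkeE.
Qed.

(** [M f] on the slice of [I], in terms of the values of [f] on the slices of
    [I] and [- I] only: its nontangential limits come from those of [f] there. *)
Definition prod_slice I (z : R * R) (p q : quaternion R) : quaternion R :=
  (bl_re a z * comp_re p q - bl_im a z * comp_im I p q)
  + I * (bl_re a z * comp_im I p q + bl_im a z * comp_re p q).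

Lemma star_blaschke_slice f I (x y : R) : slice_hyperholomorphic f -> imag_unit I -> 0 < x ->
  M f (slice_pt I x y) = prod_slice I (x, y) (f (slice_pt I x y)) (f (slice_pt (- I) x y)).
Proof.
move=> hf hI x0; rewrite (star_blaschkeE hf y hI x0) /prod_slice.
rewrite (representation hf y hI x0) (representation hf y (imag_unitN hI) x0).
by have [-> ->] := comp_slices (stem_re f (x, y)) (stem_im f (x, y)) hI.
Qed.

Lemma prod_slice_opp I z p q : prod_slice (- I) z q p =
  (bl_re a z * comp_re p q - bl_im a z * comp_im I p q)
  + - I * (bl_re a z * comp_im I p q + bl_im a z * comp_re p q).
Proof.
rewrite /prod_slice.
have -> : comp_re q p = comp_re p q by rewrite /comp_re addrC.
have -> // : comp_im (- I) q p = comp_im I p q by rewrite /comp_im mulNr -mulrN opprB.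
Qed.

Lemma comp_norm I p q : imag_unit I ->
  qsq p + qsq q = 2 * (qsq (comp_re p q) + qsq (comp_im I p q)).
Proof.
move=> hI; have [e1 e2] := comp_inv p q hI.
by have := qsq_slices (comp_re p q) (comp_im I p q) hI; rewrite e1 e2.
Qed.

Lemma prod_slice_boundary I (y : R) p q : imag_unit I ->
  qsq (prod_slice I (0, y) p q) + qsq (prod_slice (- I) (0, y) q p) = qsq p + qsq q.
Proof.
by move=> hI; rewrite prod_slice_opp /prod_slice qsq_slices// bl_boundary// -comp_norm.
Qed.

Lemma prod_slice_bound I (z : R * R) p q : imag_unit I -> 0 <= z.1 ->
  qsq (prod_slice I z p q) <= 2 * (qsq p + qsq q).
Proof.
move=> hI z0; rewrite (comp_norm p q hI) /prod_slice.
apply: (le_trans (qsqD_le _ _)); rewrite (qsqM I) (qsq_unit hI) mul1r ler_pM2l//.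
have B := bl_le1 ha z0.
set c := bl_re a z in B *; set d := bl_im a z in B *.
set al := comp_re p q; set be := comp_im I p q.
apply: (le_trans (lerD (qsqB_le _ _) (qsqD_le _ _))); rewrite !qsqM.
have -> : 2 * (qsq c * qsq al + qsq d * qsq be) + 2 * (qsq c * qsq be + qsq d * qsq al)
  = 2 * ((qsq c + qsq d) * (qsq al + qsq be)) by ring.
by rewrite ler_pM2l// ler_piMl// addr_ge0// qsq_ge0.
Qed.

(** Finiteness of the energies inside the half-space is a membership condition
    that does not enter the norm, so a crude constant suffices. *)
Lemma star_blaschke_energy f I (x : R) : slice_hyperholomorphic f -> imag_unit I -> 0 < x ->
  (slice_energy (M f) I x <= 2%:E * (slice_energy f I x + slice_energy f (- I)%R x))%E.
Proof.
move=> hf hI x0; have hI' := imag_unitN hI.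
have e g J : slice_energy g J x = (\int[mu]_y (qsq (g (slice_pt J x y)))%:E)%E.
  by apply: eq_integral => y _; rewrite qsqE.
have m1 := qsq_slice_measurable hf hI x0; have m2 := qsq_slice_measurable hf hI' x0.
have p0 J (y : R) : (0 <= (qsq (f (slice_pt J x y)))%:E)%E by rewrite lee_fin qsq_ge0.
rewrite !e -ge0_integralD//=; [|by move=> *; exact: p0..].
rewrite -ge0_integralZl//=; first last.
- by move=> y _; apply: adde_ge0; exact: p0.
- exact: emeasurable_funD.
apply: ge0_integral_mono => y; first by rewrite lee_fin qsq_ge0.
rewrite star_blaschke_slice// -EFinD -EFinM lee_fin.
by apply: prod_slice_bound => //=; exact: ltW.
Qed.

Lemma star_blaschke_nt f I (y : R) p q : slice_hyperholomorphic f -> imag_unit I ->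
  nt_limit f I y p -> nt_limit f (- I) y q ->
  nt_limit (M f) I y (prod_slice I (0, y) p q).
Proof.
move=> hf hI hp hq k k0; have {hp}hp := hp k k0; have {hq}hq := hq k k0.
set S := [set z : R * R | _] in hp hq *.
have FF : Filter (within S (nbhs ((0 : R), y))) by exact: within_filter.
have mul (F G : R * R -> quaternion R) (s t : quaternion R) :
    F z @[z --> within S (nbhs ((0 : R), y))] --> s ->
    G z @[z --> within S (nbhs ((0 : R), y))] --> t ->
    (F z * G z) @[z --> within S (nbhs ((0 : R), y))] --> s * t.
  apply: continuous2_cvg; apply: (@qmul_continuous _ _ fst snd (s, t)).
    exact: cvg_fst.
  exact: cvg_snd.
have cst (s : quaternion R) : (fun=> s) z @[z --> within S (nbhs ((0 : R), y))] --> s.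
  exact: cvg_cst.
have [c d] : {for ((0 : R), y), continuous (bl_re a)} /\ {for ((0 : R), y), continuous (bl_im a)}.
  have hz : - q0 a < ((0 : R), y).1 by rewrite /= oppr_lt0; exact: ha.
  have [dU [dV [u v _ _]]] := cr_pair_bl hz.
  by split; apply: differentiable_continuous; exact: ex_diff.
have {}c : bl_re a z @[z --> within S (nbhs ((0 : R), y))] --> bl_re a (0, y).
  exact: cvg_within_filter c.
have {}d : bl_im a z @[z --> within S (nbhs ((0 : R), y))] --> bl_im a (0, y).
  exact: cvg_within_filter d.
have hre : comp_re (f (slice_pt I z.1 z.2)) (f (slice_pt (- I) z.1 z.2))
    @[z --> within S (nbhs ((0 : R), y))] --> comp_re p q.
  by apply: cvgZr; apply: cvgD.
have him : comp_im I (f (slice_pt I z.1 z.2)) (f (slice_pt (- I) z.1 z.2))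
    @[z --> within S (nbhs ((0 : R), y))] --> comp_im I p q.
  by apply: cvgZr; apply: mul; [exact: cst | apply: cvgB].
have main : prod_slice I z (f (slice_pt I z.1 z.2)) (f (slice_pt (- I) z.1 z.2))
    @[z --> within S (nbhs ((0 : R), y))] --> prod_slice I (0, y) p q.
  apply: cvgD; first by apply: cvgB; apply: mul.
  apply: (mul _ _ _ _ (cst I)).
  exact: (cvgD (mul _ _ _ _ c him) (mul _ _ _ _ d hre)).
apply: cvg_trans main; apply: near_eq_cvg.
apply: (@filterS _ (nbhs ((0:R), y)) _ setT); last exact: filterT.
by move=> -[x' y'] _ [/= x0 _]; rewrite star_blaschke_slice.
Qed.

Lemma star_blaschke_ae f : slice_hyperholomorphic f -> ae_nt_limits f -> ae_nt_limits (M f).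
Proof.
move=> hf hl I hI; have h := ae_and (hl I hI) (hl _ (imag_unitN hI)).
apply: ae_mono h => y [[p hp] [q hq]].
by exists (prod_slice I (0, y) p q); exact: star_blaschke_nt.
Qed.

(** Slice by slice, [M f] and [f] have the same boundary energy, although their
    boundary values on a single slice need not have the same modulus. *)
Lemma star_blaschke_bdry_energy f I : slice_hyperholomorphic f -> ae_nt_limits f ->
  imag_unit I -> bdry_energy (M f) I = bdry_energy f I.
Proof.
move=> hf hl hI; have hI' := imag_unitN hI.
apply: (bdry_energy_eq hI hf hl (star_blaschke_hyper hf) (star_blaschke_ae hf hl)).
have h := ae_and (hl I hI) (hl _ hI').
apply: ae_mono h => y [[p hp] [q hq]].
have h1 := star_blaschke_nt hf hI hp hq.
have hp' : nt_limit f (- - I) y p by rewrite opprK.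
have h2 := star_blaschke_nt hf hI' hq hp'.
rewrite (bdry_sq_val h1) (bdry_sq_val h2) (bdry_sq_val hp) (bdry_sq_val hq).
by rewrite -!EFinD prod_slice_boundary.
Qed.

Lemma bdry_sup_ext f g : (forall I, imag_unit I -> bdry_energy f I = bdry_energy g I) ->
  [set bdry_energy f I | I in @imag_unit R] = [set bdry_energy g I | I in @imag_unit R].
Proof. by move=> h; apply: eq_imagel => I hI; exact: h. Qed.

Lemma H2norm_ext f g : (forall I, imag_unit I -> bdry_energy f I = bdry_energy g I) ->
  H2norm f = H2norm g.
Proof.
move=> /bdry_sup_ext E.
exact: (f_equal (fun S => Num.sqrt (fine (ereal_sup S))) E).
Qed.

Lemma H2_ae f : H2 f -> ae_nt_limits f.
Proof. by move=> [_ h _] I hI; case: (h I hI). Qed.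

Lemma double_lty (A B : \bar R) : (A < +oo -> B < +oo -> 2%:E * (A + B) < +oo)%E.
Proof. by move=> hA hB; apply: lte_mul_pinfty => //; exact: lte_add_pinfty. Qed.

Lemma star_blaschke_H2 f : H2 f -> H2 (M f).
Proof.
move=> hf; have hl := H2_ae hf; case: hf => hh hs hb; split.
- exact: star_blaschke_hyper.
- move=> I hI; split; last exact: star_blaschke_ae.
  have [s1 _] := hs I hI; have [s2 _] := hs _ (imag_unitN hI).
  set A := ereal_sup _ in s1; set B := ereal_sup _ in s2.
  apply: (@le_lt_trans _ _ (2%:E * (A + B))%E).
    apply: ge_ereal_sup => _ [x x0 <-].
    apply: (le_trans (star_blaschke_energy hh hI x0)).
    rewrite lee_pmul2l//; apply: leeD; apply: ereal_sup_ubound; by exists x.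
  exact: double_lty s1 s2.
- have E := bdry_sup_ext (fun I hI => star_blaschke_bdry_energy hh hl hI).
  exact: (eq_ind _ (fun S => ereal_sup S < +oo)%E hb _ (esym E)).
Qed.

(** Only values on the half-space are approached by nontangential limits. *)
Lemma bdry_ext f g I (y : R) : (forall p, half_space p -> f p = g p) -> imag_unit I ->
  bdry f I y = bdry g I y.
Proof.
move=> fg hI; rewrite /bdry; congr xget; apply/funext => l; apply/propext.
have H f' g' : (forall p, half_space p -> f' p = g' p) -> nt_limit f' I y l -> nt_limit g' I y l.
  move=> e h k k0; apply: cvg_trans (h k k0); apply: near_eq_cvg.
  apply: (@filterS _ (nbhs ((0:R), y)) _ setT); last exact: filterT.
  by move=> -[x' y'] _ [/= x0 _]; apply: e; rewrite /half_space /= qre_slice_pt.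
by split; apply: H => // p /fg.
Qed.

Lemma slice_hyperB f g : slice_hyperholomorphic f -> slice_hyperholomorphic g ->
  slice_hyperholomorphic (fun p => f p - g p).
Proof.
move=> hf hg; apply: (@slice_hyperholomorphic_of_stem _ _
  (fun z => stem_re f z - stem_re g z) (fun z => stem_im f z - stem_im g z)).
  move=> x y x0; have [dU [dV [u v e e']]] := stem_cr_pair y hf x0.
  have [dU' [dV' [u' v' k k']]] := stem_cr_pair y hg x0.
  have hu := is_diffB u u'; have hv := is_diffB v v'.
  exists (dU - dU'), (dV - dV'); split; [exact: hu|exact: hv| |].
    by rewrite !fctE e k opprB addrC opprK.
  by rewrite !fctE e' k'.
move=> I x y hI x0; rewrite (representation hf)// (representation hg)//.
by rewrite mulrBr opprD addrACA.
Qed.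

Lemma star_blaschkeB f g : slice_hyperholomorphic f -> slice_hyperholomorphic g ->
  forall p, half_space p -> M f p - M g p = M (fun p => f p - g p) p.
Proof.
move=> hf hg p p0; have [I hI ->] := slice_pt_surj p.
have hfg := slice_hyperB hf hg.
rewrite !star_blaschke_slice//.
have kre (s t s' t' : quaternion R) : comp_re (s - s') (t - t') = comp_re s t - comp_re s' t'.
  by rewrite /comp_re -scalerBr addrACA -opprD.
have kim (s t s' t' : quaternion R) : comp_im I (s - s') (t - t') = comp_im I s t - comp_im I s' t'.
  have e : t - t' - (s - s') = t - s - (t' - s') by rewrite !opprD !opprK addrACA.
  by rewrite /comp_im e mulrBr scalerBr.
rewrite /prod_slice kre kim.
move: (bl_re _ _) (bl_im _ _) (comp_re (f _) _) (comp_re (g _) _)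
  (comp_im _ (f _) _) (comp_im _ (g _) _) => c d r r' i i'.
rewrite !mulrDr !mulrN.
move: (c * r) (c * r') (d * i) (d * i') (I * (c * i)) (I * (c * i'))
  (I * (d * r)) (I * (d * r')) => t1 t2 t3 t4 t5 t6 t7 t8.
by apply: quatP; rewrite !(qD, qN); ring.
Qed.

Lemma ae_nt_limitsB f g : ae_nt_limits f -> ae_nt_limits g -> ae_nt_limits (fun p => f p - g p).
Proof.
move=> hf hg I hI; apply: ae_mono (ae_and (hf I hI) (hg I hI)) => y [[p hp] [q hq]].
by exists (p - q) => k k0; apply: cvgB; [exact: hp|exact: hq].
Qed.

End Multiplication.

Theorem theorem4p16 (R : realType) (a : quaternion R) (ha : half_space a) :
  H2_isometry (fun f : quaternion R -> quaternion R => star (blaschke a) f).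
Proof.
split=> [f hf|f hf|f g hf hg].
- exact: (star_blaschke_H2 ha hf).
- have [hh _ _] := hf.
  exact: H2norm_ext (fun I hI => star_blaschke_bdry_energy ha hh (H2_ae hf) hI).
have [hf' _ _] := hf; have [hg' _ _] := hg.
have hfg := slice_hyperB hf' hg'; have lfg := ae_nt_limitsB (H2_ae hf) (H2_ae hg).
apply: H2norm_ext => I hI.
apply: (etrans _ (star_blaschke_bdry_energy ha hfg lfg hI)).
apply: eq_integral => y _; congr ((qnorm _ ^+ 2)%:E).
apply: bdry_ext => // p p0; exact: (star_blaschkeB ha hf' hg' p0).
Qed.
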